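(* Let $K$ be a field of characteristic different from $2$ and let $X$ be a connected poset such that every multiplicative automorphism of $FI(X,K)$ is inner and every derivation from $FI(X,K)$ to $I(X,K)$ is inner. Let $\lambda$ be an involution on $X$ such that $\lambda(x)\ne x$ for all $x\in X$. If $\Phi$ is an involution on $D(X,K)$ that induces $\lambda$, then there exists an inner automorphism $\Psi$ of $D(X,K)$ such that $$\Phi\circ\Psi=\Psi\circ\widetilde{\rho_\lambda}\circ\widetilde{s(\Phi)\delta}\quad\text{or}\quad \Phi\circ\Psi=\Psi\circ\widetilde{\sigma_\lambda}\circ\widetilde{s(\Phi)\delta}.$$
   Context: For a field $K$ and a poset $X$, the incidence space $I(X,K)$ is the $K$-space of functions $f:X\times X\to K$ with $f(x,y)=0$ whenever $x\nleq y$. The finitary incidence algebra $FI(X,K)$ is the subspace of all $f\in I(X,K)$ such that for all $x\le y$ in $X$ there are only finitely many subintervals $[u,v]\subseteq[x,y]$ with $u\ne v$ and $f(u,v)\neq 0$. It is an associative unital $K$-algebra, with unity $\delta$, under convolution $(fg)(x,y)=\sum_{x\le z\le y}f(x,z)g(z,y)$, and the same formula makes $I(X,K)$ an $FI(X,K)$-bimodule. $D(X,K)$ is the $K$-algebra $FI(X,K)\oplus I(X,K)$, elements written as columns, with multiplication $\begin{bmatrix}f\\ i\end{bmatrix}\begin{bmatrix}g\\ j\end{bmatrix}=\begin{bmatrix}fg\\ fj+ig\end{bmatrix}$. Inner automorphisms of an algebra are the maps $a\mapsto uau^{-1}$, $u$ a unit. An involution on a $K$-algebra is a $K$-linear anti-automorphism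 whose square is the identity; an involution on a poset $X$ is a bijection $\lambda$ with $x\le y\Leftrightarrow\lambda(y)\le\lambda(x)$ and $\lambda^2=\mathrm{id}$. A poset is connected if any two elements are joined by a finite sequence in which consecutive elements are comparable. A multiplicative automorphism of $FI(X,K)$ is a map $M_\sigma(f)(x,y)=\sigma(x,y)f(x,y)$, where $\sigma\in I(X,K)$ satisfies $\sigma(x,y)\neq0$ for all $x\le y$ and $\sigma(x,y)\sigma(y,z)=\sigma(x,z)$ for $x\le y\le z$. A derivation $D:FI(X,K)\to I(X,K)$ is a $K$-linear map with $D(fg)=D(f)g+fD(g)$; it is inner if there is $i\in I(X,K)$ with $D(f)=fi-if$ for all $f$. Let $e_x\in FI(X,K)$ be $1$ at $(x,x)$ and $0$ elsewhere. An involution $\Phi$ on $D(X,K)$ induces the involution $\lambda$ on $X$ such that $\Phi\left(\begin{bmatrix}e_x\\0\end{bmatrix}\right)$ is conjugate to $\begin{bmatrix}e_{\lambda(x)}\\0\end{bmatrix}$ for every $x\in X$. For an involution $\lambda$ on $X$, $\rho_\lambda(f)(x,y)=f(\lambda(y),\lambda(x))$ for $f\in FI(X,K)$, $\overline{\rho_\lambda}$ is given by the same formula on $I(X,K)$, and $\widetilde{\rho_\lambda}\left(\begin{bmatrix}f\\ i\end{bmatrix}\right)=\begin{bmatrix}\rho_\lambda(f)\\ \overline{\rho_\lambda}(i)\end{bmatrix}$. For $k\in K^*$, $\widetilde{k\delta}\left(\begin{bmatrix}f\\ i\end{bmatrix}\right)=\begin{bmatrix}f\\ ki\end{bmatrix}$.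 Under the stated hypotheses on $X$ and $K$, every involution $\Phi$ on $D(X,K)$ has the form $\Phi=\Psi'\circ\widetilde{\rho_\lambda}\circ\widetilde{k\delta}$ with $\Psi'$ inner, $\lambda$ the involution induced by $\Phi$, and $k\in\{-1,1\}$ uniquely determined; $k$ is called the sign $s(\Phi)$ of $\Phi$. Since $\lambda$ has no fixed points, there is a partition $X=X_1\cup X_2$ into disjoint subsets such that $\lambda$ interchanges $X_1$ and $X_2$, and: if $x\in X_1$ and $y\le x$ then $y\in X_1$; if $x\in X_2$ and $x\le y$ then $y\in X_2$. Fix such a partition. Let $w\in FI(X,K)$ be the diagonal function with $w(x,x)=1$ for $x\in X_1$, $w(x,x)=-1$ for $x\in X_2$, and $w(x,y)=0$ for $x\neq y$. Then $\sigma_\lambda(f)=w\rho_\lambda(f)w^{-1}$ is an involution on $FI(X,K)$, and $\widetilde{\sigma_\lambda}\left(\begin{bmatrix}f\\ i\end{bmatrix}\right)=\begin{bmatrix}w\rho_\lambda(f)w^{-1}\\ w\overline{\rho_\lambda}(i)w^{-1}\end{bmatrix}$. *)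

(* Defs.v *)
From HB Require Import structures.
From mathcomp Require Import all_boot all_order all_algebra.
From mathcomp Require Import boolp classical_sets functions.
From mathcomp Require Import cardinality fsbigop.

Set Implicit Arguments.
Unset Strict Implicit.
Unset Printing Implicit Defensive.

Import Order.TTheory GRing.Theory.
Local Open Scope classical_set_scope.
Local Open Scope ring_scope.

(* The poset may be empty, in which case FI and Dalg below are trivial rings.
   They are therefore only pzRingTypes, and, as lalgType and algType extend
   nzRingType, their K-algebra structure is the lmodType structure together
   with the lemmas FI_scaleAl, FI_scaleAr, Dalg_scaleAl and Dalg_scaleAr. *)

Definition inner_automorphism (A : pzRingType) (phi : A -> A) : Prop :=
  exists u v : A, [/\ u * v = 1, v * u = 1 & forall a, phi a = u * a * v].

Definition conjugate (A : pzRingType) (a b : A) : Prop :=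
  exists u v : A, [/\ u * v = 1, v * u = 1 & b = u * a * v].

Definition connected_poset (d : Order.disp_t) (X : porderType d) : Prop :=
  forall x y : X, exists2 s : seq X, path >=<%O x s & last x s = y.

Record poset_involution (d : Order.disp_t) (X : porderType d) :=
  PosetInvolution {
    poset_involution_fun :> X -> X;
    poset_involution_anti :
      {mono poset_involution_fun : x y /~ (x <= y)%O};
    poset_involutionK : involutive poset_involution_fun }.

Section IncidenceSpace.
Context {d : Order.disp_t} (X : porderType d) (K : fieldType).

Definition incident : {pred X -> X -> K} :=
  fun f => `[< forall x y, ~~ (x <= y)%O -> f x y = 0 >].

Lemma incident_zmod_closed : zmod_closed incident.
Proof.
split=> [|f g /asboolP f0 /asboolP g0]; apply/asboolP => // x y xy.
by change (f x y - g x y = 0); rewrite f0 // g0 // subr0.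
Qed.

HB.instance Definition _ :=
  GRing.isZmodClosed.Build (X -> X -> K) incident incident_zmod_closed.

Record incidence := Incidence {
  incidence_val :> X -> X -> K;
  incidence_subproof : incidence_val \in incident }.

HB.instance Definition _ := [isSub for incidence_val].
HB.instance Definition _ := [Choice of incidence by <:].
HB.instance Definition _ := [SubChoice_isSubZmodule of incidence by <:].

Lemma incidenceP (f : incidence) x y : ~~ (x <= y)%O -> f x y = 0.
Proof. by case: f => f /= /asboolP; apply. Qed.

Lemma incidence_ext (f g : incidence) : (forall x y, f x y = g x y) -> f = g.
Proof. by move=> fg; apply/val_inj/funext => x; apply/funext => y. Qed.

Definition mk_incidence (f : X -> X -> K)
    (f0 : forall x y, ~~ (x <= y)%O -> f x y = 0) : incidence :=
  Incidence (introT (asboolP _) f0).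

Lemma incidence_scale_incident (a : K) (f : incidence) x y :
  ~~ (x <= y)%O -> a * f x y = 0.
Proof. by move=> xy; rewrite (incidenceP f xy) mulr0. Qed.

Definition incidence_scale (a : K) (f : incidence) : incidence :=
  mk_incidence (incidence_scale_incident a f).

Lemma incidence_scaleA a b f :
  incidence_scale a (incidence_scale b f) = incidence_scale (a * b) f.
Proof. by apply: incidence_ext => x y /=; rewrite mulrA. Qed.

Lemma incidence_scale1 : left_id 1 incidence_scale.
Proof. by move=> f; apply: incidence_ext => x y /=; rewrite mul1r. Qed.

Lemma incidence_scaleDr : right_distributive incidence_scale +%R.
Proof. by move=> a f g; apply: incidence_ext => x y; exact: mulrDr. Qed.

Lemma incidence_scaleDl f : {morph incidence_scale^~ f : a b / a + b}.
Proof. by move=> a b; apply: incidence_ext => x y; exact: mulrDl. Qed.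

HB.instance Definition _ := GRing.Zmodule_isLmodule.Build K incidence
  incidence_scaleA incidence_scale1 incidence_scaleDr incidence_scaleDl.

(* The pairs (u, v) with u < v stand for the subintervals [u, v] of [x, y]
   with u != v. *)
Definition offdiag_support (f : X -> X -> K) (x y : X) : set (X * X) :=
  [set p | [/\ (x <= p.1)%O, (p.1 < p.2)%O, (p.2 <= y)%O & f p.1 p.2 != 0]].

Definition finitary : {pred incidence} :=
  fun f => `[< forall x y, (x <= y)%O -> finite_set (offdiag_support f x y) >].

Lemma finitary_submod_closed : submod_closed finitary.
Proof.
split=> [|a f g /asboolP ff /asboolP fg]; apply/asboolP => x y xy.
  apply: (sub_finite_set (B := set0)) => // p [_ _ _] /=.
  by rewrite eqxx.
apply: (sub_finite_set (B := offdiag_support f x y `|` offdiag_support g x y)).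
  move=> p [xp p12 py fg0].
  have {}fg0 : a * f p.1 p.2 + g p.1 p.2 != 0 := fg0.
  have [f0|f0] := eqVneq (f p.1 p.2) 0; last by left.
  by right; split=> //; move: fg0; rewrite f0 mulr0 add0r.
by rewrite finite_setU; split; [exact: ff|exact: fg].
Qed.

HB.instance Definition _ :=
  GRing.isSubmodClosed.Build K incidence finitary finitary_submod_closed.

Record FI := FinitaryIncidence {
  FI_val :> incidence;
  FI_subproof : FI_val \in finitary }.

HB.instance Definition _ := [isSub for FI_val].
HB.instance Definition _ := [Choice of FI by <:].
HB.instance Definition _ := [SubChoice_isSubLmodule of FI by <:].

Lemma FI_ext (f g : FI) : (forall x y, f x y = g x y) -> f = g.
Proof. by move=> fg; apply/val_inj/incidence_ext. Qed.

Lemma FIP (f : FI) x y : finite_set (offdiag_support f x y).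
Proof.
have [xy|xy] := boolP (x <= y)%O.
  by case: f => f /= /asboolP; apply.
apply: (sub_finite_set (B := set0)) => // p [xp p12 py] _.
by move/negP: xy; apply; exact: le_trans xp (le_trans (ltW p12) py).
Qed.

Definition mk_FI (f : incidence)
    (ff : forall x y, (x <= y)%O -> finite_set (offdiag_support f x y)) : FI :=
  FinitaryIncidence (introT (asboolP _) ff).

Lemma FI_suppl (f : FI) x y :
  finite_set [set z | (z <= y)%O /\ f x z != 0].
Proof.
apply: (sub_finite_set (B := x |` (snd @` offdiag_support f x y))); last first.
  by rewrite finite_setU; split => //; apply: finite_image; exact: FIP.
move=> z [zy fxz]; have [->|zx] := eqVneq z x; first by left.
have xz : (x <= z)%O by apply: contraNT fxz => /incidenceP ->.
by right; exists (x, z) => //; split => //=; rewrite lt_neqAle eq_sym zx.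
Qed.

Lemma FI_suppr (f : FI) x y :
  finite_set [set z | (x <= z)%O /\ f z y != 0].
Proof.
apply: (sub_finite_set (B := y |` (fst @` offdiag_support f x y))); last first.
  by rewrite finite_setU; split => //; apply: finite_image; exact: FIP.
move=> z [xz fzy]; have [->|zy] := eqVneq z y; first by left.
have z_y : (z <= y)%O by apply: contraNT fzy => /incidenceP ->.
by right; exists (z, y) => //; split => //=; rewrite lt_neqAle zy.
Qed.

(* \sum_(z \in A) F z is 0 when F has infinite support on A; this does not
   happen as soon as one of the factors is finitary. *)
Definition conv_fun (f g : X -> X -> K) (x y : X) : K :=
  \sum_(z \in [set z | (x <= z)%O && (z <= y)%O]) f x z * g z y.

Lemma conv_incident (f g : incidence) x y :
  ~~ (x <= y)%O -> conv_fun f g x y = 0.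
Proof.
move=> xy; apply: fsbig1 => z /= /andP[xz zy].
by rewrite (le_trans xz zy) in xy.
Qed.

Definition conv (f g : incidence) : incidence :=
  mk_incidence (conv_incident f g).

Lemma convE (f g : incidence) x y (s : seq X) : uniq s ->
  (forall z, (x <= z)%O -> (z <= y)%O -> f x z * g z y != 0 -> z \in s) ->
  conv f g x y = \sum_(z <- s) f x z * g z y.
Proof.
move=> us sP; pose P : {pred X} := fun z => (x <= z)%O && (z <= y)%O.
have -> : conv f g x y = \sum_(z \in [set` P]) f x z * g z y.
  by apply: eq_fsbigl; apply/seteqP; split.
have sP' z : P z -> z \notin s -> f x z * g z y = 0.
  by move=> /andP[xz zy]; apply: contraNeq => /(sP _ xz zy).
rewrite -(bigfs _ us sP') big_mkcond; apply: eq_bigr => z _; case: ifP => //.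
move=> /negbT; rewrite negb_and => /orP[xz|zy].
  by rewrite (incidenceP f xz) mul0r.
by rewrite (incidenceP g zy) mulr0.
Qed.

Lemma conv_neq0 (f g : incidence) x y : conv f g x y != 0 ->
  exists z, [/\ (x <= z)%O, (z <= y)%O, f x z != 0 & g z y != 0].
Proof.
move=> h; apply: contrapT => nz; move/negP: h; apply; apply/eqP.
rewrite (@convE f g x y [::]) ?big_nil // => z xz zy.
rewrite mulf_eq0 negb_or => /andP[fz gz]; exfalso; apply: nz.
by exists z.
Qed.

Lemma finite_seq (A : set X) : finite_set A ->
  exists2 s : seq X, uniq s & forall z, A z -> z \in s.
Proof.
move=> /finite_seqP[s ->]; exists (undup s); first exact: undup_uniq.
by move=> z; rewrite mem_undup.
Qed.

Lemma conv_finitary (f g : FI) x y :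
  (x <= y)%O -> finite_set (offdiag_support (conv f g) x y).
Proof.
move=> _; have Ff := FIP f x y; have Fg := FIP g x y.
apply: (sub_finite_set (B := (offdiag_support f x y `|` offdiag_support g x y)
  `|` ((fst @` offdiag_support f x y) `*` (snd @` offdiag_support g x y)))).
  move=> [u v] [/= xu uv vy] /conv_neq0[z [uz zv fz gz]].
  have [zu|zu] := eqVneq z u; first by left; right; rewrite zu in gz.
  have [zv'|zv'] := eqVneq z v; first by left; left; rewrite zv' in fz.
  right; split=> /=.
    exists (u, z) => //; split => //=; last exact: le_trans vy.
    by rewrite lt_neqAle eq_sym zu.
  exists (z, v) => //; split => //=; first exact: le_trans uz.
  by rewrite lt_neqAle zv'.
rewrite !finite_setU; split => //.
by apply: finite_setX; exact: finite_image.
Qed.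

Definition FI_mul (f g : FI) : FI := mk_FI (@conv_finitary f g).

Definition diag_fun (c : X -> K) (x y : X) : K := if x == y then c x else 0.

Lemma diag_incident c x y : ~~ (x <= y)%O -> diag_fun c x y = 0.
Proof. by rewrite /diag_fun; case: eqVneq => [->|//]; rewrite lexx. Qed.

Lemma diag_finitary c x y : (x <= y)%O ->
  finite_set (offdiag_support (mk_incidence (@diag_incident c)) x y).
Proof.
move=> _; apply: (sub_finite_set (B := set0)) => // p [_ p12 _] /=.
by rewrite /diag_fun lt_eqF // eqxx.
Qed.

Definition diag (c : X -> K) : FI := mk_FI (@diag_finitary c).

Definition delta : FI := diag (fun=> 1).

Definition idem (e : X) : FI := diag (fun x => (x == e)%:R).

Lemma conv_diagl c (g : incidence) x y : conv (diag c) g x y = c x * g x y.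
Proof.
rewrite (@convE _ _ x y [:: x]) // => [|z _ _].
  by rewrite big_seq1 /= /diag_fun eqxx.
rewrite /= /diag_fun; case: (eqVneq x z) => [->|_]; first by rewrite mem_head.
by rewrite mul0r eqxx.
Qed.

Lemma conv_diagr c (f : incidence) x y : conv f (diag c) x y = f x y * c y.
Proof.
rewrite (@convE _ _ x y [:: y]) // => [|z _ _].
  by rewrite big_seq1 /= /diag_fun eqxx.
rewrite /= /diag_fun; case: (eqVneq z y) => [->|_]; first by rewrite mem_head.
by rewrite mulr0 eqxx.
Qed.

Lemma conv_delta (f : incidence) : conv f delta = f.
Proof. by apply: incidence_ext => x y; rewrite conv_diagr mulr1. Qed.

Lemma delta_conv (f : incidence) : conv delta f = f.
Proof. by apply: incidence_ext => x y; rewrite conv_diagl mul1r. Qed.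

Lemma incidence_linE (a : K) (f g : incidence) x y :
  (a *: f + g) x y = a * f x y + g x y.
Proof. by []. Qed.

Lemma FI_linE (a : K) (f g : FI) x y :
  (a *: f + g) x y = a * f x y + g x y.
Proof. by []. Qed.

Lemma conv_lin_l (a : K) (f g : FI) (i : incidence) :
  conv (FI_val (a *: f + g)) i = a *: conv f i + conv g i.
Proof.
apply: incidence_ext => x y.
have [s us sP] := finite_seq (FI_suppl f x y).
have [t ut tP] := finite_seq (FI_suppl g x y).
have ust : uniq (undup (s ++ t)) := undup_uniq _.
rewrite incidence_linE.
rewrite !(@convE _ _ x y (undup (s ++ t))) //.
- rewrite mulr_sumr -big_split; apply: eq_bigr => z _.
  by rewrite FI_linE mulrDl mulrA.
- move=> z xz zy; rewrite mulf_eq0 negb_or => /andP[gz _].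
  by rewrite mem_undup mem_cat tP ?orbT.
- move=> z xz zy; rewrite mulf_eq0 negb_or => /andP[fz _].
  by rewrite mem_undup mem_cat sP.
- move=> z xz zy; rewrite mulf_eq0 negb_or => /andP[+ _].
  rewrite FI_linE => fg0.
  rewrite mem_undup mem_cat; have [f0|f0] := eqVneq (f x z) 0.
    by rewrite tP ?orbT //; split=> //; move: fg0; rewrite f0 mulr0 add0r.
  by rewrite sP.
Qed.

Lemma conv_lin_l_arg (a : K) (f : FI) (i j : incidence) :
  conv f (a *: i + j) = a *: conv f i + conv f j.
Proof.
apply: incidence_ext => x y.
have [s us sP] := finite_seq (FI_suppl f x y).
rewrite incidence_linE.
rewrite !(@convE _ _ x y s) //.
- rewrite mulr_sumr -big_split; apply: eq_bigr => z _.
  by rewrite incidence_linE mulrDr mulrCA.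
all: move=> z xz zy; rewrite mulf_eq0 negb_or => /andP[fz _]; exact: sP.
Qed.

Lemma conv_lin_r (a : K) (f g : FI) (i : incidence) :
  conv i (FI_val (a *: f + g)) = a *: conv i f + conv i g.
Proof.
apply: incidence_ext => x y.
have [s us sP] := finite_seq (FI_suppr f x y).
have [t ut tP] := finite_seq (FI_suppr g x y).
have ust : uniq (undup (s ++ t)) := undup_uniq _.
rewrite incidence_linE.
rewrite !(@convE _ _ x y (undup (s ++ t))) //.
- rewrite mulr_sumr -big_split; apply: eq_bigr => z _.
  by rewrite FI_linE mulrDr mulrCA.
- move=> z xz zy; rewrite mulf_eq0 negb_or => /andP[_ gz].
  by rewrite mem_undup mem_cat tP ?orbT.
- move=> z xz zy; rewrite mulf_eq0 negb_or => /andP[_ fz].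
  by rewrite mem_undup mem_cat sP.
- move=> z xz zy; rewrite mulf_eq0 negb_or => /andP[_].
  rewrite FI_linE => fg0.
  rewrite mem_undup mem_cat; have [f0|f0] := eqVneq (f z y) 0.
    by rewrite tP ?orbT //; split=> //; move: fg0; rewrite f0 mulr0 add0r.
  by rewrite sP.
Qed.

Lemma conv_lin_r_arg (a : K) (f : FI) (i j : incidence) :
  conv (a *: i + j) f = a *: conv i f + conv j f.
Proof.
apply: incidence_ext => x y.
have [s us sP] := finite_seq (FI_suppr f x y).
rewrite incidence_linE.
rewrite !(@convE _ _ x y s) //.
- rewrite mulr_sumr -big_split; apply: eq_bigr => z _.
  by rewrite incidence_linE mulrDl mulrA.
all: move=> z xz zy; rewrite mulf_eq0 negb_or => /andP[_ fz]; exact: sP.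
Qed.

Lemma convA_supp (f g h : incidence) x y (s : seq X) : uniq s ->
  (forall w z, f x w != 0 -> g w z != 0 -> h z y != 0 ->
    w \in s /\ z \in s) ->
  conv f (conv g h) x y = conv (conv f g) h x y.
Proof.
move=> us sP.
have L w : f x w * conv g h w y = \sum_(z <- s) f x w * (g w z * h z y).
  have [->|fw] := eqVneq (f x w) 0.
    by rewrite mul0r big1 // => z _; rewrite mul0r.
  rewrite -mulr_sumr (@convE _ _ w y s) // => z _ _.
  rewrite mulf_eq0 negb_or => /andP[gz hz].
  by case: (sP w z fw gz hz).
have R z : conv f g x z * h z y = \sum_(w <- s) f x w * (g w z * h z y).
  have [->|hz] := eqVneq (h z y) 0.
    by rewrite mulr0 big1 // => w _; rewrite !mulr0.
  under eq_bigr do rewrite mulrA.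
  rewrite -mulr_suml (@convE _ _ x z s) // => w _ _.
  rewrite mulf_eq0 negb_or => /andP[fw gw].
  by case: (sP w z fw gw hz).
rewrite (@convE f _ x y s) //; last first.
  move=> w _ _; rewrite mulf_eq0 negb_or => /andP[fw] /conv_neq0[z [_ _ gz hz]].
  by case: (sP w z fw gz hz).
rewrite (@convE _ h x y s) //; last first.
  move=> z _ _; rewrite mulf_eq0 negb_or => /andP[] /conv_neq0[w [_ _ fw gw]] hz.
  by case: (sP w z fw gw hz).
under eq_bigr do rewrite L.
rewrite exchange_big /=.
by under [RHS]eq_bigr do rewrite R.
Qed.

Lemma nz_le (f : incidence) x y : f x y != 0 -> (x <= y)%O.
Proof. by apply: contraNT => /incidenceP ->. Qed.

Lemma convA_ll (f g : FI) (i : incidence) :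
  conv f (conv g i) = conv (conv f g) i.
Proof.
apply: incidence_ext => x y.
have F : finite_set (\bigcup_(w in [set z | (z <= y)%O /\ f x z != 0])
    [set z | (z <= y)%O /\ g w z != 0]).
  by apply: bigcup_finite => [|w _]; exact: FI_suppl.
have [s us sP] := finite_seq (FI_suppl f x y).
have [t ut tP] := finite_seq F.
apply: (convA_supp (undup_uniq (s ++ t))) => w z fw gw iz.
have zy := nz_le iz; have wy := le_trans (nz_le gw) zy.
have sw : w \in s by exact: sP.
have tz : z \in t by apply: tP; exists w.
by rewrite !mem_undup !mem_cat sw tz orbT.
Qed.

Lemma convA_lr (f g : FI) (i : incidence) :
  conv f (conv i g) = conv (conv f i) g.
Proof.
apply: incidence_ext => x y.
have [s us sP] := finite_seq (FI_suppl f x y).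
have [t ut tP] := finite_seq (FI_suppr g x y).
apply: (convA_supp (undup_uniq (s ++ t))) => w z fw iw gz.
have xw := nz_le fw; have wz := nz_le iw; have zy := nz_le gz.
have sw : w \in s by apply: sP; split=> //; exact: le_trans zy.
have tz : z \in t by apply: tP; split=> //; exact: le_trans wz.
by rewrite !mem_undup !mem_cat sw tz orbT.
Qed.

Lemma convA_rr (f g : FI) (i : incidence) :
  conv i (conv f g) = conv (conv i f) g.
Proof.
apply: incidence_ext => x y.
have F : finite_set (\bigcup_(w in [set z | (x <= z)%O /\ g z y != 0])
    [set z | (x <= z)%O /\ f z w != 0]).
  by apply: bigcup_finite => [|w _]; exact: FI_suppr.
have [s us sP] := finite_seq (FI_suppr g x y).
have [t ut tP] := finite_seq F.
apply: (convA_supp (undup_uniq (s ++ t))) => w z iw fw gz.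
have xw := nz_le iw; have xz := le_trans xw (nz_le fw).
have sz : z \in s by exact: sP.
have tw : w \in t by apply: tP; exists z.
by rewrite !mem_undup !mem_cat sz tw orbT.
Qed.

Lemma FI_mulA : associative FI_mul.
Proof. by move=> f g h; apply: val_inj; exact: convA_ll. Qed.

Lemma FI_mul1r : left_id delta FI_mul.
Proof. by move=> f; apply: val_inj; exact: delta_conv. Qed.

Lemma FI_mulr1 : right_id delta FI_mul.
Proof. by move=> f; apply: val_inj; exact: conv_delta. Qed.

Lemma FI_mulDl : left_distributive FI_mul +%R.
Proof.
move=> f g h; apply: val_inj.
by have := conv_lin_l 1 f g h; rewrite !scale1r.
Qed.

Lemma FI_mulDr : right_distributive FI_mul +%R.
Proof.
move=> f g h; apply: val_inj.
by have := conv_lin_r 1 g h f; rewrite !scale1r.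
Qed.

HB.instance Definition _ := GRing.Zmodule_isPzRing.Build FI
  FI_mulA FI_mul1r FI_mulr1 FI_mulDl FI_mulDr.

Definition lact (f : FI) (i : incidence) : incidence := conv f i.
Definition ract (i : incidence) (f : FI) : incidence := conv i f.

Lemma conv_scaleAl (a : K) (f g : incidence) :
  a *: conv f g = conv (a *: f) g.
Proof.
apply: incidence_ext => x y; change (a * conv_fun f g x y
  = \sum_(z \in [set z | (x <= z)%O && (z <= y)%O]) a * f x z * g z y).
by rewrite mulr_fsumr; under eq_fsbigr do rewrite mulrA.
Qed.

Lemma conv_scaleAr (a : K) (f g : incidence) :
  a *: conv f g = conv f (a *: g).
Proof.
apply: incidence_ext => x y; change (a * conv_fun f g x y
  = \sum_(z \in [set z | (x <= z)%O && (z <= y)%O]) f x z * (a * g z y)).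
by rewrite mulr_fsumr; under eq_fsbigr do rewrite mulrCA.
Qed.

Lemma FI_scaleAl (a : K) (f g : FI) : a *: (f * g) = (a *: f) * g.
Proof. by apply: val_inj; exact: conv_scaleAl. Qed.

Lemma FI_scaleAr (a : K) (f g : FI) : a *: (f * g) = f * (a *: g).
Proof. by apply: val_inj; exact: conv_scaleAr. Qed.

Definition multiplicative_function (sigma : incidence) : Prop :=
  (forall x y, (x <= y)%O -> sigma x y != 0) /\
  (forall x y z, (x <= y)%O -> (y <= z)%O ->
     sigma x y * sigma y z = sigma x z).

Lemma mult_incident (sigma f : incidence) x y :
  ~~ (x <= y)%O -> sigma x y * f x y = 0.
Proof. by move=> xy; rewrite (incidenceP f xy) mulr0. Qed.

Lemma mult_finitary (sigma : incidence) (f : FI) x y : (x <= y)%O ->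
  finite_set (offdiag_support (mk_incidence (mult_incident sigma f)) x y).
Proof.
move=> _; apply: sub_finite_set (FIP f x y) => p [xp p12 py] /=.
by rewrite mulf_eq0 negb_or => /andP[_ fp].
Qed.

Definition mult_map (sigma : incidence) (f : FI) : FI :=
  mk_FI (@mult_finitary sigma f).

Definition derivation (D : {linear FI -> incidence}) : Prop :=
  forall f g : FI, D (f * g) = ract (D f) g + lact f (D g).

Definition inner_derivation (D : FI -> incidence) : Prop :=
  exists i : incidence, forall f, D f = lact f i - ract i f.

Definition Dalg := (FI * incidence)%type.
HB.instance Definition _ := GRing.Lmodule.copy Dalg (FI * incidence)%type.

Definition Dalg_one : Dalg := (1, 0).
Definition Dalg_mul (a b : Dalg) : Dalg :=
  (a.1 * b.1, lact a.1 b.2 + ract a.2 b.1).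

Lemma lactD (f : FI) i j : lact f (i + j) = lact f i + lact f j.
Proof. by have := conv_lin_l_arg 1 f i j; rewrite !scale1r. Qed.
Lemma lactDl (f g : FI) i : lact (f + g) i = lact f i + lact g i.
Proof. by have := conv_lin_l 1 f g i; rewrite !scale1r. Qed.
Lemma ractD (f : FI) i j : ract (i + j) f = ract i f + ract j f.
Proof. by have := conv_lin_r_arg 1 f i j; rewrite !scale1r. Qed.
Lemma ractDr (f g : FI) i : ract i (f + g) = ract i f + ract i g.
Proof. by have := conv_lin_r 1 f g i; rewrite !scale1r. Qed.
Lemma lact0 (f : FI) : lact f 0 = 0.
Proof. by apply: (@addrI _ (lact f 0)); rewrite -lactD !addr0. Qed.
Lemma ract0 (f : FI) : ract 0 f = 0.
Proof. by apply: (@addrI _ (ract 0 f)); rewrite -ractD !addr0. Qed.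

Lemma Dalg_mulA : associative Dalg_mul.
Proof.
move=> a b c; rewrite /Dalg_mul /= mulrA; congr pair.
by rewrite lactD ractD /lact /ract convA_ll convA_lr convA_rr addrA.
Qed.

Lemma Dalg_mul1r : left_id Dalg_one Dalg_mul.
Proof.
by case=> f i; rewrite /Dalg_mul /= mul1r ract0 addr0 /lact delta_conv.
Qed.

Lemma Dalg_mulr1 : right_id Dalg_one Dalg_mul.
Proof.
by case=> f i; rewrite /Dalg_mul /= mulr1 lact0 add0r /ract conv_delta.
Qed.

Lemma Dalg_mulDl : left_distributive Dalg_mul +%R.
Proof.
move=> a b c; rewrite /Dalg_mul /= mulrDl lactDl ractD.
by congr pair; rewrite addrACA.
Qed.

Lemma Dalg_mulDr : right_distributive Dalg_mul +%R.
Proof.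
move=> a b c; rewrite /Dalg_mul /= mulrDr lactD ractDr.
by congr pair; rewrite addrACA.
Qed.

HB.instance Definition _ := GRing.Zmodule_isPzRing.Build Dalg
  Dalg_mulA Dalg_mul1r Dalg_mulr1 Dalg_mulDl Dalg_mulDr.

Lemma Dalg_scaleAl (a : K) (u v : Dalg) : a *: (u * v) = (a *: u) * v.
Proof.
congr pair; first exact: FI_scaleAl.
by rewrite [LHS]scalerDr; congr (_ + _); exact: conv_scaleAl.
Qed.

Lemma Dalg_scaleAr (a : K) (u v : Dalg) : a *: (u * v) = u * (a *: v).
Proof.
congr pair; first exact: FI_scaleAr.
by rewrite [LHS]scalerDr; congr (_ + _); exact: conv_scaleAr.
Qed.

Definition is_involution (Phi : {linear Dalg -> Dalg}) : Prop :=
  (forall a b, Phi (a * b) = Phi b * Phi a) /\ involutive Phi.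

Definition induces (Phi : Dalg -> Dalg) (lambda : poset_involution X) : Prop :=
  forall x, conjugate (Phi (idem x, 0)) ((idem (lambda x), 0) : Dalg).

Section Rho.
Variable lambda : poset_involution X.

Definition rho_fun (f : X -> X -> K) (x y : X) : K := f (lambda y) (lambda x).

Lemma rho_incident (f : incidence) x y : ~~ (x <= y)%O -> rho_fun f x y = 0.
Proof.
by move=> xy; apply: incidenceP; rewrite poset_involution_anti.
Qed.

Definition rho_bar (f : incidence) : incidence :=
  mk_incidence (@rho_incident f).

Lemma rho_finitary (f : FI) x y : (x <= y)%O ->
  finite_set (offdiag_support (rho_bar f) x y).
Proof.
move=> _; have Ff := FIP f (lambda y) (lambda x).
apply: sub_finite_set
  (finite_image (fun p : X * X => (lambda p.2, lambda p.1)) Ff).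
move=> [u v] [/= xu uv vy fuv]; exists (lambda v, lambda u) => /=; last first.
  by rewrite !poset_involutionK.
split => //=; rewrite ?poset_involution_anti //.
rewrite lt_neqAle poset_involution_anti ltW // andbT.
by rewrite (inj_eq (inv_inj (@poset_involutionK _ _ lambda))) gt_eqF.
Qed.

Definition rho (f : FI) : FI := mk_FI (@rho_finitary f).

Definition rho_tilde (a : Dalg) : Dalg := (rho a.1, rho_bar a.2).

Definition is_partition (X1 X2 : set X) : Prop :=
  [/\ X1 `|` X2 = setT, X1 `&` X2 = set0,
      lambda @` X1 = X2 /\ lambda @` X2 = X1,
      (forall x y, X1 x -> (y <= x)%O -> X1 y) &
      (forall x y, X2 x -> (x <= y)%O -> X2 y)].

Definition w_coef (X1 : set X) (x : X) : K := if x \in X1 then 1 else -1.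
Definition w (X1 : set X) : FI := diag (w_coef X1).
Definition w_inv (X1 : set X) : FI := diag (fun x => (w_coef X1 x)^-1).

Lemma w_coef_neq0 X1 x : w_coef X1 x != 0.
Proof. by rewrite /w_coef; case: ifP; rewrite ?oppr_eq0 oner_neq0. Qed.

Lemma w_mulV X1 : w X1 * w_inv X1 = 1.
Proof.
apply: FI_ext => x y; change (conv (w X1) (w_inv X1) x y = delta x y).
rewrite conv_diagl /= /diag_fun; case: eqVneq => [->|_]; last exact: mulr0.
by rewrite divff // w_coef_neq0.
Qed.

Lemma w_Vmul X1 : w_inv X1 * w X1 = 1.
Proof.
apply: FI_ext => x y; change (conv (w_inv X1) (w X1) x y = delta x y).
rewrite conv_diagl /= /diag_fun; case: eqVneq => [->|_]; last exact: mulr0.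
by rewrite mulVf // w_coef_neq0.
Qed.

Definition sigma_tilde (X1 : set X) (a : Dalg) : Dalg :=
  (w X1 * rho a.1 * w_inv X1, ract (lact (w X1) (rho_bar a.2)) (w_inv X1)).

End Rho.

Lemma is_partition_exists (lambda : poset_involution X) :
  (forall x, lambda x <> x) -> exists X1 X2, is_partition lambda X1 X2.
Proof.
move=> nofix; pose lK := @poset_involutionK _ _ lambda.
pose P (A : set X) := (forall x y, A x -> (y <= x)%O -> A y) /\
  (forall x, A x -> ~ A (lambda x)).
have [|A [[Adown Aind] Amax]] := @Zorn_bigcup X P.
  move=> F FP Ftot; split=> [x y [B FB Bx] yx|x [B FB Bx] [C FC Clx]].
    by exists B => //; exact: (FP _ FB).1 yx.
  have [BC|CB] := Ftot _ _ FB FC.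
    by apply: (FP _ FC).2 Clx; exact: BC.
  by apply: (FP _ FB).2 Bx _; exact: CB.
have ext z : ~ (lambda z <= z)%O -> ~ A (lambda z) -> A z.
  move=> nz nAlz; apply: contrapT => nAz.
  pose B : set X := A `|` [set u | (u <= z)%O].
  have AB : A `<` B.
    by split=> [u Au|/(_ z (or_intror (lexx z)))//]; left.
  apply: (Amax B AB).
  split=> [u v [Au|/= uz] vu|u Bu Blu].
  - by left; exact: Adown vu.
  - by right; exact: le_trans uz.
  have swap a b : (lambda a <= b)%O -> (lambda b <= a)%O.
    by rewrite -{1}(lK b) poset_involution_anti.
  case: Bu Blu => [Au|/= uz] [Alu|/= luz].
  - exact: Aind Alu.
  - by apply: nAlz; apply: Adown Au _; exact: swap.
  - by apply: nAlz; apply: Adown Alu _; rewrite poset_involution_anti.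
  - by apply: nz; apply: le_trans uz; exact: swap.
have cover x : ~ A x -> A (lambda x).
  move=> nAx; apply: contrapT => nAlx.
  have [xlx|/negP xlx] := boolP (lambda x <= x)%O; last by apply/nAx/ext.
  apply/nAlx/ext; rewrite lK // => lxx.
  by apply: (nofix x); apply: le_anti; rewrite xlx lxx.
exists A, (~` A); split.
- exact: setUv.
- exact: setICr.
- split; apply/seteqP; split=> [_ [x Ax <-]|x nAx].
  + exact: Aind.
  + by exists (lambda x); [exact: cover|exact: lK].
  + exact: cover.
  + by exists (lambda x); [exact: Aind|exact: lK].
- exact: Adown.
- by move=> x y nAx xy Ay; apply: nAx; exact: Adown xy.
Qed.

Definition scale_tilde (k : K) (a : Dalg) : Dalg := (a.1, k *: a.2).

Definition is_sign (Phi : Dalg -> Dalg) (k : K) : Prop :=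
  (k = -1 \/ k = 1) /\
  exists (lambda : poset_involution X) (Psi : Dalg -> Dalg),
    [/\ induces Phi lambda, inner_automorphism Psi &
        Phi =1 Psi \o rho_tilde lambda \o scale_tilde k].

(* The value is 0 if no k satisfies is_sign Phi k. *)
Definition involution_sign (Phi : Dalg -> Dalg) : K := xget 0 [set k | is_sign Phi k].

End IncidenceSpace.

Arguments conv {d X K}.
Arguments diag {d X K}.

(* Main.v *)
Require Import Defs.
From HB Require Import structures.
From mathcomp Require Import all_boot all_order all_algebra.
From mathcomp Require Import boolp classical_sets functions.
From mathcomp Require Import cardinality fsbigop.
From mathcomp Require Import ring.

Set Implicit Arguments.
Unset Strict Implicit.
Unset Printing Implicit Defensive.

Import Order.TTheory GRing.Theory.
Local Open Scope classical_set_scope.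
Local Open Scope ring_scope.

(** Write D for D(X,K) and E_x for [e_x; 0].

    The first step is to write Phi as a |-> u th(a) u^-1, where th is the
    composition of rho_lambda with [f; i] |-> [f; k i] and k is 1 or -1. The
    composition al of Phi with rho_lambda is an automorphism of D taking each
    E_x to a conjugate of E_x. The element whose y-th column is the y-th column
    of al(E_y), for every y, conjugates all the E_x to the al(E_x) at once; it
    exists because its first component is finitary (column_finitary), and it
    is a unit whose inverse is built from rows (eD_simultaneously_conjugate).
    An automorphism that fixes all the E_x acts entrywise, by
    [f; i] |-> [s f; t f + c s i], with s multiplicative and c constant by
    connectedness. As multiplicative automorphisms are inner, s can be removed;
    t f is then a derivation of f, hence inner, and is removed in turn
    (automorphism_fixing_eD). Applying Phi twice to the central element
    [0; delta] gives c ^ 2 = 1, so that Phi has a sign (involution_has_sign).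

    The second step improves u. As Phi is involutive, th(u) = z u with z
    central, and the centre of D consists of the [r delta; s delta]
    (center_Dalg). Multiplying u by a central element gives th(u) = u or
    th(u) = - u (normalize_unit); replacing th by its composition with
    conjugation by w turns the second case into the first.

    The last step is pure ring theory. Let E be the idempotent with support
    X_1. As lambda exchanges X_1 and X_2, and X_1 is a lower set,
    th(E) = 1 - E and (1 - E) D E = 0. For this triangular decomposition every
    th-symmetric unit u has the form v th(v)
    (antiinvolution_symmetric_unit), and then conjugation by v intertwines Phi
    with th (antiinvolution_conjugation). *)

(** * Symmetric units of a ring with anti-involution *)

Lemma mul_conj_inv (R : pzRingType) (u u' v v' : R) :
  u * u' = 1 -> v * v' = 1 -> (u * v) * (v' * u') = 1.
Proof. by move=> uu vv; rewrite mulrA -(mulrA u) vv mulr1. Qed.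

Lemma mul_conj_cancel (R : pzRingType) (u u' v w t : R) :
  u' * u = 1 -> v * u' * (u * t * u') * (u * w) = v * t * w.
Proof.
by move=> uu; rewrite !mulrA -(mulrA v) uu mulr1 -(mulrA _ u' u) uu mulr1.
Qed.

(** With F = 1 - E, the unit a is block triangular, with blocks A = E a E,
    U = E a F and D = F a F, and symmetry means that th exchanges A and D and
    fixes U. Then b = E + U / 2 + D satisfies b th(b) = a. Division by 2 is
    multiplication by the central element h. *)
Lemma antiinvolution_symmetric_unit (R : pzRingType) (th : R -> R)
    (E h a a' : R) :
  (forall x y, th (x + y) = th x + th y) ->
  (forall x y, th (x * y) = th y * th x) -> involutive th ->
  E * E = E -> th E = 1 - E -> (forall x, (1 - E) * x * E = 0) ->
  (forall x, h * x = x * h) -> h + h = 1 -> th h = h ->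
  a * a' = 1 -> a' * a = 1 -> th a = a ->
  exists b b', [/\ b * b' = 1, b' * b = 1 & a = b * th b].
Proof.
move=> thD thM thK EE thE corner hC hh thh aa' a'a tha.
set F := 1 - E in thE corner.
have EF : E * F = 0 by rewrite mulrBr mulr1 EE subrr.
have FE : F * E = 0 by rewrite mulrBl mul1r EE subrr.
have FF : F * F = F by rewrite {1}/F mulrBl mul1r EF subr0.
have thF : th F = E by rewrite -thE thK.
have EpF : E + F = 1 by rewrite addrC subrK.
pose A := E * a * E; pose U := E * a * F; pose D := F * a * F.
pose D' := F * a' * F; pose V := U * D'.
have EA : E * A = A by rewrite /A !mulrA EE.
have EU : E * U = U by rewrite /U !mulrA EE.
have EV : E * V = V by rewrite /V mulrA EU.
have ED : E * D = 0 by rewrite /D !mulrA EF !mul0r.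
have ED' : E * D' = 0 by rewrite /D' !mulrA EF !mul0r.
have UF : U * F = U by rewrite /U -mulrA FF.
have DF : D * F = D by rewrite /D -mulrA FF.
have UE : U * E = 0 by rewrite /U -mulrA FE mulr0.
have DE : D * E = 0 by rewrite /D -mulrA FE mulr0.
have D'E : D' * E = 0 by rewrite /D' -mulrA FE mulr0.
have VE : V * E = 0 by rewrite /V -mulrA D'E mulr0.
have UA : U * A = 0 by rewrite -EA mulrA UE mul0r.
have UU : U * U = 0 by rewrite -{2}EU mulrA UE mul0r.
have DU : D * U = 0 by rewrite -EU mulrA DE mul0r.
have D'U : D' * U = 0 by rewrite -EU mulrA D'E mul0r.
have DA : D * A = 0 by rewrite -EA mulrA DE mul0r.
have UV : U * V = 0 by rewrite /V mulrA UU mul0r.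
have DV : D * V = 0 by rewrite /V mulrA DU mul0r.
have VU : V * U = 0 by rewrite /V -mulrA D'U mulr0.
have FxF x : F * x * F = F * x by rewrite [in LHS]mulrBr mulr1 corner subr0.
have DD' : D * D' = F by rewrite /D /D' !FxF !mulrA FxF -(mulrA F) aa' mulr1.
have D'D : D' * D = F by rewrite /D /D' !FxF !mulrA FxF -(mulrA F) a'a mulr1.
have VD : V * D = U by rewrite /V -mulrA D'D UF.
have aE : a = A + U + D.
  rewrite /A /U /D -mulrDr EpF mulr1 -[LHS]mul1r -EpF mulrDl; congr (_ + _).
  by rewrite -[LHS]mulr1 -EpF mulrDr corner add0r.
have hL x y : x * (h * y) = h * (x * y) by rewrite mulrA -hC mulrA.
have hU : h * U + h * U = U by rewrite -mulrDl hh mul1r.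
have thb : th (E + h * U + D) = F + h * U + A.
  rewrite !thD thE; congr (_ + _ + _).
    by rewrite thM thh /U !thM thF tha thE -hC !mulrA.
  by rewrite /D !thM thF tha mulrA.
have UD' : U * D' = V by [].
(* Only the multiplication table of the blocks is used below. *)
clearbody V; clearbody D' D U A F.
(* D' is the inverse of the block D, and V = U D'. *)
exists (E + h * U + D), (E - h * V + D'); split.
- rewrite !mulrDr !mulrDl !mulrN !hL -!mulrA EE UE DE EV ED' UD' UV DV DD'.
  by rewrite !mulr0 oppr0 !addr0 !add0r addrA subrK.
- rewrite !mulrDr !mulrDl !mulNr !hL -!mulrA EE VE D'E EU VU D'U ED VD D'D.
  by rewrite !mulr0 oppr0 !addr0 !add0r addrA addrK.
rewrite thb !mulrDr !mulrDl !hL -!mulrA EF UF DF EU UU DU EA UA DA.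
rewrite !mulr0 !addr0 !add0r aE -[in LHS]hU -[LHS]addrA [RHS]addrC.
by rewrite [in LHS]addrAC.
Qed.

(** The involution x |-> a th(x) a^-1 is conjugate to th by the unit b with
    a = b th(b). *)
Lemma antiinvolution_conjugation (R : pzRingType) (th : R -> R)
    (E h a a' : R) :
  (forall x y, th (x + y) = th x + th y) ->
  (forall x y, th (x * y) = th y * th x) -> involutive th ->
  E * E = E -> th E = 1 - E -> (forall x, (1 - E) * x * E = 0) ->
  (forall x, h * x = x * h) -> h + h = 1 -> th h = h ->
  a * a' = 1 -> a' * a = 1 -> th a = a ->
  exists b b', [/\ b * b' = 1, b' * b = 1 &
    forall x, a * th (b * x * b') * a' = b * th x * b'].
Proof.
move=> thD thM thK EE thE corner hC hh thh aa' a'a tha.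
have [b [b' [bb' b'b ab]]] := antiinvolution_symmetric_unit
  thD thM thK EE thE corner hC hh thh aa' a'a tha.
exists b, b'; split=> // x.
have th1 : th 1 = 1 by rewrite -[RHS]thK -[th 1 in RHS]mul1r thM thK mul1r.
have e1 : a * th b' = b by rewrite ab -mulrA -thM b'b th1 mulr1.
have e2 : th b * a' = b' by rewrite -[LHS]mul1r -b'b -mulrA (mulrA b) -ab aa' mulr1.
by rewrite !thM !mulrA e1 -mulrA e2.
Qed.

(** * Entries of elements of D(X,K) *)

Section Entries.
Context {d : Order.disp_t} {X : porderType d} {K : fieldType}.
Implicit Types (a b : Dalg X K) (x y z p q : X) (S : set X).

Lemma Dalg_ext a b : (forall x y, a.1 x y = b.1 x y) ->
  (forall x y, a.2 x y = b.2 x y) -> a = b.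
Proof.
by case: a b => [f i] [g j] /= /FI_ext -> /incidence_ext ->.
Qed.

Lemma Dalg_mul2E a b x y :
  (a * b).2 x y = conv a.1 b.2 x y + conv a.2 b.1 x y.
Proof. by []. Qed.

Lemma conv0 (i : incidence X K) x y : conv (0 : incidence X K) i x y = 0.
Proof. by apply: fsbig1 => z _; exact: mul0r. Qed.

Lemma conv_0 (i : incidence X K) x y : conv i (0 : incidence X K) x y = 0.
Proof. by apply: fsbig1 => z _; exact: mulr0. Qed.

(** The element of D with first component the diagonal function of coefficient
    c and second component 0. *)
Definition diagD (c : X -> K) : Dalg X K := (diag c, 0).

Lemma diagD_mul1 c a x y : (diagD c * a).1 x y = c x * a.1 x y.
Proof. exact: conv_diagl. Qed.

Lemma diagD_mul2 c a x y : (diagD c * a).2 x y = c x * a.2 x y.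
Proof.
by rewrite -[RHS]addr0; congr (_ + _); [exact: conv_diagl|exact: conv0].
Qed.

Lemma mul_diagD1 c a x y : (a * diagD c).1 x y = a.1 x y * c y.
Proof. exact: conv_diagr. Qed.

Lemma mul_diagD2 c a x y : (a * diagD c).2 x y = a.2 x y * c y.
Proof.
by rewrite -[RHS]add0r; congr (_ + _); [exact: conv_0|exact: conv_diagr].
Qed.

Definition diagDE := (diagD_mul1, diagD_mul2, mul_diagD1, mul_diagD2).

Lemma conv_diag_entry (i j : incidence X K) x : conv i j x x = i x x * j x x.
Proof.
rewrite (@convE _ _ _ _ _ x x [:: x]) ?big_seq1 // => z xz zx _.
by rewrite inE; apply/eqP/le_anti; rewrite xz zx.
Qed.

Lemma conv_idem_conv (i j : incidence X K) x y z :
  conv (conv i (idem K z)) j x y = i x z * j z y.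
Proof.
rewrite (@convE _ _ _ _ _ x y [:: z]) ?big_seq1 // => [|w _ _].
  by rewrite conv_diagr eqxx mulr1.
rewrite conv_diagr inE /=; case: (eqVneq w z) => // _.
by rewrite mulr0 mul0r eqxx.
Qed.

End Entries.

(** The diagonal idempotent [e_x; 0]. It is convertible to (idem K x, 0), the
    form in which it occurs in the definition of an induced involution. *)
Local Notation eD x := (diagD (fun y => (y == x)%:R)).

Section DiagonalIdempotents.
Context {d : Order.disp_t} {X : porderType d} {K : fieldType}.
Implicit Types (a b : Dalg X K) (x y z p q : X) (S : set X).

Lemma mul_eD_mul1 a b x y z :
  (a * eD z * b).1 x y = a.1 x z * b.1 z y.
Proof. exact: conv_idem_conv. Qed.

Lemma mul_eD_mul2 a b x y z :
  (a * eD z * b).2 x y = a.1 x z * b.2 z y + a.2 x z * b.1 z y.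
Proof.
have h : (a * eD z).2 = conv a.2 (idem K z).
  by rewrite -[LHS]/(lact _ _ + ract _ _) lact0 add0r.
by rewrite Dalg_mul2E h !conv_idem_conv.
Qed.

(** An element is determined by its corners E_p a E_q. *)
Lemma eD_mul_eq a b :
  (forall p q, eD p * a * eD q = eD p * b * eD q) -> a = b.
Proof.
move=> h; apply: Dalg_ext => x y.
  have := congr1 (fun c : Dalg X K => c.1 x y) (h x y).
  by rewrite !diagDE !eqxx !mul1r !mulr1.
have := congr1 (fun c : Dalg X K => c.2 x y) (h x y).
by rewrite !diagDE !eqxx !mul1r !mulr1.
Qed.

Lemma diagD_eq c c' : c =1 c' -> diagD c = diagD c' :> Dalg X K.
Proof. by move=> /funext ->. Qed.

Lemma diagDM c c' :
  diagD c * diagD c' = diagD (fun x => c x * c' x) :> Dalg X K.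
Proof.
apply: Dalg_ext => p q; rewrite !diagDE /=; last by rewrite mulr0.
by rewrite /diag_fun; case: (eqVneq p q) => [->|]; rewrite ?mulr0.
Qed.

Lemma Dalg_one1 x y : (1 : Dalg X K).1 x y = (x == y)%:R.
Proof. by rewrite /= /diag_fun; case: eqP. Qed.

Lemma Dalg_one2 x y : (1 : Dalg X K).2 x y = 0.
Proof. by []. Qed.

(** * Finitariness of column families *)

(** A fixed-point free function on an infinite set Q has an infinite free
    subset: a maximal free S works if it is infinite; otherwise the points of Q
    outside S and f(S) are mapped into S by maximality, and they are infinitely
    many and form a free set. *)
Lemma infinite_free_subset {T : Type} (Q : set T) (f : T -> T) :
  infinite_set Q -> (forall t, Q t -> f t <> t) ->
  exists S : set T, [/\ S `<=` Q, infinite_set S & forall t, S t -> ~ S (f t)].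
Proof.
move=> Qinf fQ.
have [|S [[SQ Sfree] Smax]] := @Zorn_bigcup T
    (fun S : set T => S `<=` Q /\ forall t, S t -> ~ S (f t)).
  move=> F FP Ftot; split=> [q [B /FP[BQ _] /BQ//]|q [B FB Bq] [C FC Cfq]].
  have [BC|CB] := Ftot _ _ FB FC.
    by apply: (FP _ FC).2 Cfq; exact: BC.
  by apply: (FP _ FB).2 Bq _; exact: CB.
have [Sfin|] := pselect (finite_set S); last by move=> Sinf; exists S.
exists ((Q `&` f @^-1` S) `\` S); split=> [q [[]]//||q [[_ Sfq] _] [_]] //.
move=> Tfin; apply: Qinf.
apply: (sub_finite_set (B := S `|` f @` S `|` ((Q `&` f @^-1` S) `\` S))).
  move=> q Qq; have [Sq|Sq] := pselect (S q); first by left; left.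
  have [fSq|fSq] := pselect ((f @` S) q); first by left; right.
  right; split=> //; split=> //; apply: contrapT => Sfq.
  apply: (Smax (S `|` [set q])).
    by split=> [|/(_ q (or_intror erefl))//]; exact: subsetUl.
  split=> [r [/SQ//|->//]|r [Sr|->] [Sfr|fr]] //.
  - exact: (Sfree _ Sr).
  - by apply: fSq; exists r.
  - exact: fQ fr.
by rewrite !finite_setU; split=> //; split=> //; exact: finite_image.
Qed.

Lemma finite_maximal (A : set X) : finite_set A -> A !=set0 ->
  exists2 m, A m & forall p, A p -> ~~ (m < p)%O.
Proof.
move=> /finite_seqP[s ->] [x0]; rewrite /mkset.
elim: s x0 => // x s IHs x0 _.
case: s IHs => [_|y s IHs].
  by exists x; rewrite /= ?mem_head // => p; rewrite inE => /eqP ->; rewrite ltxx.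
have [m ms mmax] := IHs y (mem_head _ _).
have [mx|mx] := boolP (m < x)%O.
  exists x => [|p]; rewrite /= ?mem_head // inE => /orP[/eqP ->|/mmax].
    by rewrite ltxx.
  by apply: contra; exact: lt_trans.
exists m => [|p]; first by rewrite /= inE [_ \in _]ms orbT.
by rewrite /= inE => /orP[/eqP ->|/mmax].
Qed.

(** The functions E [set q] play the role of orthogonal idempotents
    indexed by X, and E S that of the sum of those with index in S. If infinitely
    many columns q had a nonzero off-diagonal entry in [x, y], take for each of
    them a maximal such row f q. On a free set S of such indices the entries of
    E S at (f q, q) and of E [set q] at (f q, q) agree, so that E S would not
    be finitary. *)
Lemma column_finitary (E : set X -> FI X K) :
  (forall S q, S q -> E S * E [set q] = E [set q]) ->
  (forall S p, ~ S p -> E S p p = 0) ->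
  (forall q, E [set q] q q = 1) ->
  forall x y, finite_set (offdiag_support (fun p q => E [set q] p q) x y).
Proof.
move=> EM E0 E1 x y.
pose A q := [set p | [/\ (x <= p)%O, (p < q)%O & E [set q] p q != 0]].
pose Q := [set q | (q <= y)%O /\ A q !=set0].
suff Qfin : finite_set Q.
  apply: (sub_finite_set
    (B := \bigcup_(q in Q) offdiag_support (E [set q]) x y)).
    by move=> [p q] [/= xp pq qy Epq]; exists q => //; split=> //; exists p.
  by apply: bigcup_finite => // q _; exact: FIP.
have Afin q : finite_set (A q).
  by apply: sub_finite_set (FI_suppr (E [set q]) x q) => p [].
have /choice[f fP] : forall q, exists p, Q q ->
    A q p /\ forall r, A q r -> ~~ (p < r)%O.
  move=> q; have [[qy Aq]|nQq] := pselect (Q q); last by exists q.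
  by have [m Am mmax] := finite_maximal (Afin q) Aq; exists m.
apply: contrapT => Qinf.
have [q /fP[[_ + _] _] fq|S [SQ Sinf Sfree]] := @infinite_free_subset _ Q f Qinf.
  by rewrite fq ltxx.
apply: Sinf; apply: sub_finite_set (finite_image snd (FIP (E S) x y)) => q Sq.
have [qy _] := SQ _ Sq; have [[xp pq Epq] pmax] := fP q (SQ _ Sq).
(* By maximality of f q only the terms z = f q and z = q can contribute. *)
exists (f q, q) => //; split=> //=.
suff -> : E S (f q) q = E [set q] (f q) q by [].
have := congr1 (fun h : FI X K => h (f q) q) (EM S q Sq) => /= <-.
rewrite -[RHS]/(conv (E S) (E [set q]) (f q) q).
rewrite (@convE _ _ _ _ _ _ _ [:: f q; q]); first last.
- move=> z pz zq; rewrite mulf_eq0 negb_or => /andP[_ Ez].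
  rewrite !inE; apply: contraT; rewrite negb_or => /andP[zp zq'].
  have /pmax : A q z by split; rewrite ?(le_trans xp) // lt_neqAle zq' zq.
  by rewrite lt_neqAle eq_sym zp pz.
- by rewrite /= inE lt_eqF.
by rewrite big_cons big_seq1 E1 mulr1 (E0 S (f q)) ?mul0r ?add0r //; exact: Sfree.
Qed.
End DiagonalIdempotents.

(** * Conjugation, reversal along an involution, idempotents *)

Section Conjugation.
Context {d : Order.disp_t} {X : porderType d} {K : fieldType}.
Implicit Types (a b : Dalg X K) (x y z p q : X) (S : set X).

Lemma Dalg_diag1 a b x : (a * b).1 x x = a.1 x x * b.1 x x.
Proof. exact: conv_diag_entry. Qed.

Lemma Dalg_diag2 a b x :
  (a * b).2 x x = a.1 x x * b.2 x x + a.2 x x * b.1 x x.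
Proof. by rewrite -!conv_diag_entry. Qed.

Lemma conjugate_diag1 a b x : conjugate a b -> b.1 x x = a.1 x x.
Proof.
move=> [u [v [uv _ ->]]]; rewrite !Dalg_diag1 mulrAC -Dalg_diag1 uv.
by rewrite Dalg_one1 eqxx mul1r.
Qed.

Lemma conjugate_diag2 a b x : conjugate a b -> b.2 x x = a.2 x x.
Proof.
move=> [u [v [uv _ ->]]].
have := congr1 (fun c : Dalg X K => c.2 x x) uv.
have := congr1 (fun c : Dalg X K => c.1 x x) uv.
rewrite !Dalg_diag1 !Dalg_diag2 !Dalg_diag1 Dalg_one1 Dalg_one2 eqxx.
move: (u.1 x x) (u.2 x x) (v.1 x x) (v.2 x x) (a.1 x x) (a.2 x x).
move=> u1 u2 v1 v2 a1 a2 e1 e2.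
rewrite [RHS](_ : _ = a2 * true%:R + a1 * 0); last by rewrite mulr1 mulr0 addr0.
by rewrite -e1 -e2; ring.
Qed.

Lemma conv_rho (lam : poset_involution X) (f g : incidence X K) :
  conv (rho_bar lam f) (rho_bar lam g) = rho_bar lam (conv g f).
Proof.
apply: incidence_ext => x y; rewrite /= /rho_fun /= /conv_fun.
have lK := @poset_involutionK _ _ lam.
rewrite [RHS](reindex_fsbig lam [set z | (x <= z)%O && (z <= y)%O]).
  by apply: eq_fsbigr => z _ /=; rewrite mulrC.
split=> [z /= /andP[xz zy]|z t _ _|z /= /andP[yz zx]].
- by rewrite /= !poset_involution_anti zy.
- exact: (inv_inj lK).
- exists (lam z); rewrite ?lK //=.
  by rewrite -(lK x) -(lK y) !poset_involution_anti zx.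
Qed.

Lemma rho_tildeM (lam : poset_involution X) a b :
  rho_tilde lam (a * b) = rho_tilde lam b * rho_tilde lam a.
Proof.
apply: Dalg_ext => x y.
  exact (congr1 (fun f : incidence X K => f x y) (esym (conv_rho lam b.1 a.1))).
rewrite [RHS]Dalg_mul2E [RHS]addrC; congr (_ + _).
  exact (congr1 (fun f : incidence X K => f x y) (esym (conv_rho lam b.2 a.1))).
exact (congr1 (fun f : incidence X K => f x y) (esym (conv_rho lam b.1 a.2))).
Qed.

Lemma rho_tildeK (lam : poset_involution X) :
  involutive (rho_tilde lam : Dalg X K -> Dalg X K).
Proof.
move=> a; apply: Dalg_ext => x y;
  by rewrite /= /rho_fun /= /rho_fun !poset_involutionK.
Qed.

Lemma rho_tilde_linear (lam : poset_involution X) :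
  linear (rho_tilde lam : Dalg X K -> Dalg X K).
Proof. by move=> c a b; apply: Dalg_ext. Qed.

HB.instance Definition _ (lam : poset_involution X) :=
  GRing.isLinear.Build K (Dalg X K) (Dalg X K) *:%R (rho_tilde lam)
    (rho_tilde_linear lam).

Lemma rho_tilde_diagD (lam : poset_involution X) c :
  rho_tilde lam (diagD c : Dalg X K) = diagD (c \o lam).
Proof.
apply: Dalg_ext => x y //=; rewrite /rho_fun /= /diag_fun eq_sym.
rewrite (inj_eq (inv_inj (@poset_involutionK _ _ lam))).
by case: eqP => [->|].
Qed.

Lemma rho_tilde_eD (lam : poset_involution X) x :
  rho_tilde lam (eD x : Dalg X K) = eD (lam x).
Proof.
rewrite rho_tilde_diagD; apply: diagD_eq => y /=.
by rewrite -{1}(poset_involutionK lam x) (inj_eq (inv_inj (@poset_involutionK _ _ lam))).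
Qed.

Lemma rho_tilde1 (lam : poset_involution X) : rho_tilde lam (1 : Dalg X K) = 1.
Proof. exact: (rho_tilde_diagD lam (fun=> 1)). Qed.

(** The diagonal idempotent with support S, which is the sum of the E_x with x
    in S. *)
Definition indD (S : set X) : Dalg X K := diagD (fun x => `[< S x >]%:R).

Lemma indD1 q : indD [set q] = eD q.
Proof.
by apply: diagD_eq => x; congr (nat_of_bool _)%:R; apply/asboolP/eqP.
Qed.

Lemma indD_eD S q : indD S * eD q = if `[< S q >] then eD q else 0.
Proof.
rewrite diagDM; apply: Dalg_ext => x y; last by case: ifP.
rewrite /= /diag_fun; case: (eqVneq x y) => [<-|xy].
  case: (eqVneq x q) => [->|xq]; case: ifP => /=; rewrite ?mulr0 ?mul0r ?mulr1 //=.
  - by rewrite /diag_fun !eqxx.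
  - by rewrite /diag_fun !eqxx (negPf xq).
by case: ifP; rewrite //= /diag_fun (negPf xy).
Qed.

Lemma eD_mul_eD p q : eD p * eD q = (if p == q then eD p else 0) :> Dalg X K.
Proof.
rewrite -[in LHS]indD1 indD_eD.
have -> : `[< [set p] q >] = (p == q) by apply/asboolP/eqP => [->|->].
by case: eqP => [->|].
Qed.

Lemma eD_neq0 x : eD x != 0 :> Dalg X K.
Proof.
apply/eqP => /(congr1 (fun c : Dalg X K => c.1 x x)) /= /eqP.
by rewrite /diag_fun !eqxx oner_eq0.
Qed.

End Conjugation.

(** * Simultaneous conjugation of the diagonal idempotents *)

Section SimultaneousConjugation.
Context {d : Order.disp_t} {X : porderType d} {K : fieldType}.
Implicit Types (a b : Dalg X K) (x y z p q : X) (S : set X).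

(** The element whose y-th column is the y-th column of al E_y, for all y. The
    second component is not subject to any finiteness condition. *)
Lemma column_element (al : {linear Dalg X K -> Dalg X K}) :
  (forall a b, al (a * b) = al a * al b) ->
  (forall x, conjugate (al (eD x)) (eD x)) ->
  exists u : Dalg X K, forall p q,
    u.1 p q = (al (eD q)).1 p q /\ u.2 p q = (al (eD q)).2 p q.
Proof.
move=> alM alC; pose E S := (al (indD S)).1.
have ES S q : S q -> E S * E [set q] = E [set q].
  by move=> Sq; rewrite -[LHS]/(al _ * al _).1 -alM indD1 indD_eD asboolT // /E indD1.
have E1 q : E [set q] q q = 1.
  by rewrite /E indD1 -(conjugate_diag1 _ (alC q)) /= /diag_fun !eqxx.
have E0 S p : ~ S p -> E S p p = 0.
  move=> nSp; have := congr1 (fun c : Dalg X K => c.1 p p) (alM (indD S) (eD p)).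
  rewrite indD_eD asboolF // linear0 Dalg_diag1 -indD1.
  by rewrite -/(E _) -/(E _) E1 mulr1 => <-.
have fin := column_finitary ES E0 E1.
have inc1 p q : ~~ (p <= q)%O -> (fun p q => (al (eD q)).1 p q) p q = 0.
  by move=> pq; exact: incidenceP.
have inc2 p q : ~~ (p <= q)%O -> (fun p q => (al (eD q)).2 p q) p q = 0.
  by move=> pq; exact: incidenceP.
have fin1 x y : (x <= y)%O -> finite_set (offdiag_support (mk_incidence inc1) x y).
  move=> _; apply: sub_finite_set (fin x y) => -[p q] [/= xp pq qy h].
  by split=> //=; rewrite /E indD1.
by exists (mk_FI fin1, mk_incidence inc2).
Qed.

(** The same with rows, by applying the result on columns to the conjugate of
    al by the anti-automorphism rho_tilde lam. *)
Lemma row_element (lam : poset_involution X)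
    (al : {linear Dalg X K -> Dalg X K}) :
  (forall a b, al (a * b) = al a * al b) ->
  (forall x, conjugate (al (eD x)) (eD x)) ->
  exists v : Dalg X K, forall p q,
    v.1 p q = (al (eD p)).1 p q /\ v.2 p q = (al (eD p)).2 p q.
Proof.
move=> alM alC.
pose al' : {linear Dalg X K -> Dalg X K} :=
  rho_tilde lam \o al \o rho_tilde lam.
have lK := @poset_involutionK _ _ lam.
have [a b|x|u uP] := @column_element al'.
- by rewrite /al' /= !rho_tildeM alM rho_tildeM.
- rewrite /al' /= rho_tilde_eD; have [u [v [uv vu e]]] := alC (lam x).
  exists (rho_tilde lam v), (rho_tilde lam u); rewrite -!rho_tildeM uv vu rho_tilde1.
  by split=> //; rewrite mulrA -e rho_tilde_eD lK.
exists (rho_tilde lam u) => p q; have [] := uP (lam q) (lam p).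
by rewrite /al' /= rho_tilde_eD lK /rho_fun /= !lK.
Qed.

Lemma eD_mulr_ext a b : (forall q, a * eD q = b * eD q) -> a = b.
Proof. by move=> h; apply: eD_mul_eq => p q; rewrite -!mulrA h. Qed.

Lemma eD_mull_ext a b : (forall q, eD q * a = eD q * b) -> a = b.
Proof. by move=> h; apply: eD_mul_eq => p q; rewrite h. Qed.

(** Both components of an element commuting with all the E_x are diagonal. *)
Lemma centralizer_eD a : (forall x, a * eD x = eD x * a) ->
  forall x y, x != y -> a.1 x y = 0 /\ a.2 x y = 0.
Proof.
move=> ac x y xy; split.
  have := congr1 (fun c : Dalg X K => c.1 x y) (ac x).
  by rewrite !diagDE eqxx mul1r (eq_sym y) (negPf xy) mulr0.
have := congr1 (fun c : Dalg X K => c.2 x y) (ac x).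
by rewrite !diagDE eqxx mul1r (eq_sym y) (negPf xy) mulr0.
Qed.

(** An idempotent commuting with all the E_x is diagonal with idempotent
    coefficients in the local ring of dual numbers, hence 0 or 1; the value 0 is excluded by
    the last hypothesis. *)
Lemma diag_idempotent1 a : a * a = a -> (forall x, a * eD x = eD x * a) ->
  (forall x, a * eD x != 0) -> a = 1.
Proof.
move=> aa ac an.
have off1 x y xy := (centralizer_eD ac (x := x) (y := y) xy).1.
have off2 x y xy := (centralizer_eD ac (x := x) (y := y) xy).2.
have d1 x : a.1 x x = 1.
  have e1 : a.1 x x * a.1 x x = a.1 x x by rewrite -Dalg_diag1 aa.
  have e2 : a.1 x x * a.2 x x + a.2 x x * a.1 x x = a.2 x x.
    by rewrite -Dalg_diag2 aa.
  have [a0|a0] := eqVneq (a.1 x x) 0; last by apply: (mulfI a0); rewrite mulr1.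
  case/eqP: (an x); rewrite a0 mul0r mulr0 addr0 in e2.
  have Z c y z : (y != x -> c y x = 0) -> c x x = 0 -> c y z * (z == x)%:R = 0 :> K.
    move=> c0 cx; have [->|_] := eqVneq z x; last by rewrite mulr0.
    by have [->|/c0 ->] := eqVneq y x; rewrite ?cx mul0r.
  apply: Dalg_ext => y z; rewrite !diagDE.
    exact (Z a.1 y z (off1 y x) a0).
  exact (Z a.2 y z (off2 y x) (esym e2)).
have d2 x : a.2 x x = 0.
  have : a.1 x x * a.2 x x + a.2 x x * a.1 x x = a.2 x x by rewrite -Dalg_diag2 aa.
  by rewrite d1 mul1r mulr1 -[RHS]addr0 => /addrI.
apply: Dalg_ext => x y.
  by rewrite Dalg_one1; case: (eqVneq x y) => [<-|/off1].
by rewrite Dalg_one2; case: (eqVneq x y) => [<-|/off2].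
Qed.

(** With u made of columns and v made of rows, al(E_x) u = u E_x and
    v al(E_x) = E_x v, from which v u = 1. The idempotent u v is then 1
    because its preimage under al commutes with all the E_x. *)
Lemma eD_simultaneously_conjugate (lam : poset_involution X)
    (al : {linear Dalg X K -> Dalg X K}) (alV : Dalg X K -> Dalg X K) :
  (forall a b, al (a * b) = al a * al b) -> cancel al alV -> cancel alV al ->
  (forall x, conjugate (al (eD x)) (eD x)) ->
  exists u v : Dalg X K, [/\ u * v = 1, v * u = 1 &
    forall x, al (eD x) * u = u * eD x].
Proof.
move=> alM alK alVK alC.
have [u uP] := column_element alM alC.
have [v vP] := row_element lam alM alC.
have hu q : u * eD q = al (eD q) * eD q.
  by apply: Dalg_ext => x y; rewrite !diagDE;
  (have [->|] := eqVneq y q; last by rewrite !mulr0);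
  rewrite !mulr1 ?(uP x q).1 ?(uP x q).2.
have hv p : eD p * v = eD p * al (eD p).
  by apply: Dalg_ext => x y; rewrite !diagDE;
  (have [->|] := eqVneq x p; last by rewrite !mul0r);
  rewrite !mul1r ?(vP p y).1 ?(vP p y).2.
have alE p q : al (eD p) * al (eD q) = if p == q then al (eD p) else 0.
  by rewrite -alM eD_mul_eD; case: ifP; rewrite ?linear0.
have cu x : al (eD x) * u = u * eD x.
  apply: eD_mulr_ext => q; rewrite -!mulrA hu mulrA alE eD_mul_eD.
  by case: eqP => [->|_]; rewrite ?hu // mul0r mulr0.
have cv x : v * al (eD x) = eD x * v.
  apply: eD_mull_ext => p; rewrite !mulrA hv -mulrA alE eD_mul_eD.
  by case: eqP => [->|_]; rewrite ?hv // mul0r mulr0.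
have vu : v * u = 1.
  apply: eD_mul_eq => p q; rewrite mulr1 mulrA hv -!mulrA hu.
  rewrite (mulrA (al _)) alE eD_mul_eD.
  case: (eqVneq p q) => [<-|_]; last by rewrite mul0r mulr0.
  have h : eD p * (al (eD p) * eD p) = eD p.
    apply: Dalg_ext => x y; rewrite !diagDE.
      have [->|xp] := eqVneq x p; have [->|yp] := eqVneq y p;
        rewrite ?mulr0 ?mul0r ?mulr1 ?mul1r /= /diag_fun ?eqxx //.
      - by rewrite -(conjugate_diag1 _ (alC p)) /= /diag_fun !eqxx.
      - by rewrite eq_sym (negPf yp).
      - by rewrite (negPf xp).
      - by case: eqP => //; rewrite (negPf xp).
    have [->|xp] := eqVneq x p; have [->|yp] := eqVneq y p;
      rewrite ?mulr0 ?mul0r ?mulr1 ?mul1r //.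
    by rewrite -(conjugate_diag2 _ (alC p)).
  exact: h.
exists u, v; split=> //.
have -> : u * v = al (alV (u * v)) by rewrite alVK.
have al1 : al 1 = 1 by rewrite -[al 1]mulr1 -[X in _ * X](alVK 1) -alM mul1r alVK.
rewrite -[RHS]al1; congr (al _).
have al_inj := can_inj alK.
apply: diag_idempotent1 => [|x|x].
- by apply: al_inj; rewrite alM alVK mulrA -(mulrA u) vu mulr1.
- by apply: al_inj; rewrite !alM alVK mulrA cu -!mulrA cv.
apply/eqP => h; have /eqP[] := eD_neq0 (K := K) x.
have : al (alV (u * v) * eD x) = 0 by rewrite h linear0.
rewrite alM alVK -mulrA cv => e.
by rewrite -[LHS]mul1r -[LHS]mulr1 -vu -!mulrA (mulrA _ v) (mulrA u) e mul0r mulr0.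
Qed.
End SimultaneousConjugation.

(** * Matrix units *)

Section MatrixUnits.
Context {d : Order.disp_t} {X : porderType d} {K : fieldType}.
Implicit Types (a b : Dalg X K) (x y z p q : X) (S : set X).

Lemma munit_incident x y p q :
  ~~ (p <= q)%O -> [&& (x <= y)%O, p == x & q == y]%:R = 0 :> K.
Proof. by move=> pq; case: and3P => // -[xy /eqP px /eqP qy]; rewrite px qy xy in pq. Qed.

(** The matrix unit at (x, y), which is 0 unless x <= y. *)
Definition munit x y : incidence X K := mk_incidence (@munit_incident x y).

Lemma munit_finitary x y p q : (p <= q)%O ->
  finite_set (offdiag_support (munit x y) p q).
Proof.
move=> _; apply: sub_finite_set (finite_set1 (x, y)) => -[u v] [/= _ _ _].
by case: and3P => [[_ /eqP -> /eqP ->]//|]; rewrite eqxx.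
Qed.

(** The matrix units of the two components of D. *)
Definition eF x y : Dalg X K := (mk_FI (@munit_finitary x y), 0).
Definition eI x y : Dalg X K := (0, munit x y).

Lemma eF1 x y p q : (eF x y).1 p q = [&& (x <= y)%O, p == x & q == y]%:R.
Proof. by []. Qed.
Lemma eF2 x y p q : (eF x y).2 p q = 0.
Proof. by []. Qed.
Lemma eI1 x y p q : (eI x y).1 p q = 0.
Proof. by []. Qed.
Lemma eI2 x y p q : (eI x y).2 p q = [&& (x <= y)%O, p == x & q == y]%:R.
Proof. by []. Qed.

Lemma Dalg_lin1 c a b x y : (c *: a + b).1 x y = c * a.1 x y + b.1 x y.
Proof. by []. Qed.
Lemma Dalg_lin2 c a b x y : (c *: a + b).2 x y = c * a.2 x y + b.2 x y.
Proof. by []. Qed.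
Lemma Dalg_scale1 c a x y : (c *: a).1 x y = c * a.1 x y.
Proof. by []. Qed.
Lemma Dalg_scale2 c a x y : (c *: a).2 x y = c * a.2 x y.
Proof. by []. Qed.

(** The corner E_x D E_y is spanned by eF x y and eI x y. *)
Lemma corner_decomp a x y :
  eD x * a * eD y = a.1 x y *: eF x y + a.2 x y *: eI x y.
Proof.
have H (f : incidence X K) p q : (p == x)%:R * f p q * (q == y)%:R =
    f x y * [&& (x <= y)%O, p == x & q == y]%:R.
  have [->|] := eqVneq p x; have [->|] := eqVneq q y;
    rewrite ?andbF ?mulr0 ?mul0r ?andbT // mulr1 mul1r.
  by have [_|/incidenceP ->] := boolP (x <= y)%O; rewrite ?mulr1 ?mulr0 ?mul0r.
apply: Dalg_ext => p q; rewrite !diagDE.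
  rewrite Dalg_lin1 Dalg_scale1 eF1 eI1 mulr0 addr0; exact: H.
rewrite Dalg_lin2 Dalg_scale2 eF2 eI2 mulr0 add0r; exact: H.
Qed.

Lemma corner1 a x y : (eD x * a * eD y).1 x y = a.1 x y.
Proof. by rewrite !diagDE !eqxx mul1r mulr1. Qed.
Lemma corner2 a x y : (eD x * a * eD y).2 x y = a.2 x y.
Proof. by rewrite !diagDE !eqxx mul1r mulr1. Qed.

Lemma matrix_units_mul x y z : (x <= y)%O -> (y <= z)%O ->
  [/\ eF x y * eD y = eF x y, eI x y * eD y = eI x y,
      eF x y * eF y z = eF x z, eI x y * eF y z = eI x z &
      eF x y * eI y z = eI x z].
Proof.
move=> xy yz; have xz := le_trans xy yz.
have h1 : eF x y * eD y = eF x y.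
  apply: Dalg_ext => p q; rewrite !diagDE ?eF2 ?mul0r // eF1.
  by case: (q == y); rewrite ?mulr1 // !andbF mul0r.
have h2 : eI x y * eD y = eI x y.
  apply: Dalg_ext => p q; rewrite !diagDE ?eI1 ?mul0r // eI2.
  by case: (q == y); rewrite ?mulr1 // !andbF mul0r.
have B (s v : bool) : [&& true, s & true]%:R * [&& true, true & v]%:R
    = [&& true, s & v]%:R :> K.
  by rewrite /= andbT -natrM mulnb.
split=> //.
- rewrite -h1; apply: Dalg_ext => p q; rewrite ?mul_eD_mul1 ?mul_eD_mul2.
    by rewrite !eF1 xy yz xz !eqxx B.
  by rewrite !eF2 mulr0 mul0r addr0.
- rewrite -h2; apply: Dalg_ext => p q; rewrite ?mul_eD_mul1 ?mul_eD_mul2.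
    by rewrite !eI1 mul0r.
  by rewrite eI1 mul0r add0r !eF1 ?eI2 xy yz xz !eqxx B.
- rewrite -h1; apply: Dalg_ext => p q; rewrite ?mul_eD_mul1 ?mul_eD_mul2.
    by rewrite !eI1 mulr0.
  by rewrite eI1 mulr0 addr0 !eF1 ?eI2 xy yz xz !eqxx B.
Qed.

Lemma eD_mul_eF x y : eD x * eF x y = eF x y :> Dalg X K.
Proof.
apply: Dalg_ext => p q; rewrite !diagDE ?eF2 ?mulr0 // eF1.
by case: (p == x); rewrite ?mul1r // !andbF mul0r.
Qed.

Lemma connected_constant (T : Type) (f : X -> T) : connected_poset X ->
  (forall x y, (x <= y)%O -> f x = f y) -> forall x y, f x = f y.
Proof.
move=> connX fle x y; have [s sp <-] := connX x y.
elim: s x sp => //= z s IHs x /andP[/orP[xz|zx] sp].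
  by rewrite -(IHs z sp); apply: fle.
by rewrite -(IHs z sp); apply/esym/fle.
Qed.
End MatrixUnits.

(** * Automorphisms fixing the diagonal idempotents *)

Section InnerScale.
Context {d : Order.disp_t} {X : porderType d} {K : fieldType}.
Implicit Types (a b : Dalg X K) (x y z p q : X) (S : set X).

(** The two inclusions FI(X,K) -> D and I(X,K) -> D. *)
Definition inF (f : FI X K) : Dalg X K := (f, 0).
Definition inI (i : incidence X K) : Dalg X K := (0, i).

Lemma inFM f g : inF f * inF g = inF (f * g).
Proof.
apply: Dalg_ext => x y //.
by rewrite -[RHS]addr0; congr (_ + _); [exact: conv_0|exact: conv0].
Qed.

Lemma inI_mul i a : inI i * a = inI (ract i a.1).
Proof.
apply: Dalg_ext => x y; first exact: conv0.
by rewrite -[RHS]add0r; congr (_ + _); exact: conv0.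
Qed.

Lemma mul_inI i a : a * inI i = inI (lact a.1 i).
Proof.
apply: Dalg_ext => x y; first exact: conv_0.
by rewrite -[RHS]addr0; congr (_ + _); exact: conv_0.
Qed.

Lemma inI_mul_inI i j : inI i * inI j = 0.
Proof.
rewrite inI_mul /= -[RHS]/(inI 0); congr inI.
by apply: incidence_ext => x y; exact: conv_0.
Qed.

(** An injective endomorphism fixing the E_x preserves the corners E_x D E_y, so it is
    given by the coefficients s, t and c of the images of the matrix units:
    eF x y |-> s x y * eF x y + t x y * eI x y and eI x x |-> c x * eI x x. *)
Lemma automorphism_fixing_eD (x0 : X) (connX : connected_poset X)
  (multX : forall sigma : incidence X K,
     multiplicative_function sigma -> inner_automorphism (mult_map sigma))
  (derX : forall D : {linear FI X K -> incidence X K},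
     derivation D -> inner_derivation D)
  (be : {linear Dalg X K -> Dalg X K}) :
  (forall a b, be (a * b) = be a * be b) -> injective be ->
  (forall x, be (eD x) = eD x) ->
  exists k u v, [/\ u * v = 1, v * u = 1 & forall a, be a = u * scale_tilde k a * v].
Proof.
move=> beM be_inj beE.
pose c x := (be (eI x x)).2 x x.
have s_inc x y : ~~ (x <= y)%O -> (fun x y => (be (eF x y)).1 x y) x y = 0.
  exact: incidenceP.
pose s : incidence X K := mk_incidence s_inc.
pose t x y := (be (eF x y)).2 x y.
have corner a x y : eD x * be a * eD y = be (eD x * a * eD y).
  by rewrite !beM !beE.
have bI0 x : (be (eI x x)).1 x x = 0.
  have := congr1 (fun a : Dalg X K => (be a).1 x x) (inI_mul_inI (munit x x) (munit x x)).
  by rewrite beM linear0 Dalg_diag1 => /eqP; rewrite mulf_eq0 => /orP[] /eqP.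
have bI x y : (x <= y)%O -> [/\ (be (eI x y)).1 x y = 0,
    (be (eI x y)).2 x y = c x * s x y & c x * s x y = s x y * c y].
  move=> xy; have [xID _ _ xIy _] := matrix_units_mul (K := K) (lexx x) xy.
  have [xFD _ _ _ xyI] := matrix_units_mul (K := K) xy (lexx y).
  have e : be (eI x y) = be (eI x x) * eD x * be (eF x y).
    rewrite -beE -!beM.
    by case: (matrix_units_mul (K := K) (lexx x) (lexx x)) => _ -> _ _ _; rewrite xIy.
  have e' : be (eI x y) = be (eF x y) * eD y * be (eI y y).
    by rewrite -beE -!beM xFD xyI.
  have e2 : (be (eI x y)).2 x y = c x * s x y.
    by rewrite e mul_eD_mul2 bI0 mul0r add0r.
  split=> //; first by rewrite e mul_eD_mul1 bI0 mul0r.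
  by rewrite -e2 e' mul_eD_mul2 bI0 mulr0 addr0.
have cs0 x y : (x <= y)%O -> c x * s x y != 0.
  move=> xy; have [b1 b2 _] := bI x y xy.
  apply/eqP => cs0; have e : eD x * eI x y * eD y = eI x y :> Dalg X K.
    by rewrite corner_decomp eI1 eI2 xy !eqxx scale0r add0r scale1r.
  have : be (eI x y) = be 0.
    by rewrite linear0 -e -corner corner_decomp b1 b2 cs0 !scale0r addr0.
  move=> /be_inj /(congr1 (fun a : Dalg X K => a.2 x y)) /eqP.
  by rewrite eI2 xy !eqxx oner_eq0.
have s0 x y : (x <= y)%O -> s x y != 0.
  by move=> /cs0; rewrite mulf_eq0 negb_or => /andP[].
have cE x y : (x <= y)%O -> c x = c y.
  by move=> xy; have [_ _] := bI x y xy; rewrite mulrC => /(mulfI (s0 _ _ xy)).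
have ck x : c x = c x0 := connected_constant connX cE x x0.
have be1 a x y : (x <= y)%O -> (be a).1 x y = a.1 x y * s x y.
  move=> xy; rewrite -corner1 corner corner_decomp linearP linearZ.
  by rewrite Dalg_lin1 Dalg_scale1; have [-> _ _] := bI x y xy; rewrite mulr0 addr0.
have be2 a x y : (x <= y)%O ->
    (be a).2 x y = a.1 x y * t x y + a.2 x y * (c x0 * s x y).
  move=> xy; rewrite -corner2 corner corner_decomp linearP linearZ.
  by rewrite Dalg_lin2 Dalg_scale2; have [_ -> _] := bI x y xy; rewrite ck.
have s_mult : multiplicative_function s.
  split=> // x y z xy yz; have [xFD _ xFz _ _] := matrix_units_mul (K := K) xy yz.
  have xz := le_trans xy yz.
  rewrite [RHS]/= -xFz -xFD beM beM beE mul_eD_mul1 //.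
(* Conjugation by et fixes the E_x, so et is diagonal and s is a coboundary. *)
have [et [et' [etV Vet eteq]]] := multX s s_mult.
pose h x := et x x; pose h' x := et' x x.
have HV : inF et * inF et' = 1 by rewrite inFM etV.
have VH : inF et' * inF et = 1 by rewrite inFM Vet.
have sxx x : s x x = 1.
  by apply: (mulfI (s0 x x (lexx x))); rewrite mulr1; apply: s_mult.2.
have conjE f : inF et * inF f * inF et' = inF (mult_map s f).
  by rewrite !inFM eteq.
have ids x : mult_map s (idem K x) = idem K x.
  apply: FI_ext => p q; rewrite /= /diag_fun; case: eqP => [->|]; last by rewrite mulr0.
  by rewrite [X in X * _]sxx mul1r.
have Hc x : inF et * eD x = eD x * inF et.
  have e : inF et * eD x * inF et' = eD x by rewrite (conjE (idem K x)) ids.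
  by rewrite -[X in X * inF et]e -!mulrA VH mulr1.
have Hc' x : inF et' * eD x = eD x * inF et'.
  by rewrite -[LHS]mulr1 -HV mulrA -(mulrA _ (eD x)) -Hc !mulrA VH mul1r.
have HE : inF et = diagD h.
  apply: Dalg_ext => x y //; rewrite /= /diag_fun; case: eqVneq => [<-//|xy].
  exact: (centralizer_eD Hc xy).1.
have HE' : inF et' = diagD h'.
  apply: Dalg_ext => x y //; rewrite /= /diag_fun; case: eqVneq => [<-//|xy].
  exact: (centralizer_eD Hc' xy).1.
have hV x : h x * h' x = 1.
  by have := congr1 (fun a : Dalg X K => a.1 x x) HV; rewrite Dalg_diag1 Dalg_one1 eqxx.
have sh x y : (x <= y)%O -> s x y = h x * h' y.
  move=> xy; have := congr1 (fun a : Dalg X K => a.1 x y) (conjE (eF x y).1).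
  rewrite HE HE' !diagDE /= -/(eF x y).1.
  by rewrite xy !eqxx !mulr1 => <-.
(* After this conjugation the first component is left fixed. *)
pose ga a := inF et' * be a * inF et.
have ga1 a : (ga a).1 = a.1.
  apply: FI_ext => x y; have [xy|xy] := boolP (x <= y)%O; last by rewrite !incidenceP.
  rewrite /ga HE HE' !diagDE be1 // sh //.
  rewrite [LHS](_ : _ = a.1 x y * (h x * h' x) * (h y * h' y)); last by ring.
  by rewrite !hV !mulr1.
have t'_inc x y : ~~ (x <= y)%O -> (fun x y => h' x * t x y * h y) x y = 0.
  by move=> xy; rewrite /t incidenceP // mulr0 mul0r.
pose t' := mk_incidence t'_inc.
pose D (f : FI X K) : incidence X K := mk_incidence (mult_incident t' f).
have ga2 a : (ga a).2 = D a.1 + c x0 *: a.2.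
  apply: incidence_ext => x y; have [xy|xy] := boolP (x <= y)%O; last by rewrite !incidenceP.
  rewrite /ga HE HE' !diagDE be2 // sh //.
  rewrite -[RHS]/(h' x * t x y * h y * a.1 x y + c x0 * a.2 x y).
  rewrite [LHS](_ : _ = h' x * t x y * h y * a.1 x y +
    c x0 * a.2 x y * (h x * h' x) * (h y * h' y)); last by ring.
  by rewrite !hV !mulr1.
have gaM a b : ga (a * b) = ga a * ga b.
  by rewrite /ga beM !mulrA -(mulrA _ (inF et)) HV mulr1.
have Dlin : linear D.
  by move=> r f g; apply: incidence_ext => x y; rewrite /= mulrDr mulrCA.
pose DL : {linear FI X K -> incidence X K} :=
  HB.pack D (GRing.isLinear.Build K (FI X K) (incidence X K) *:%R D Dlin).
have Dder : derivation DL.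
  have gaF f : ga (inF f) = (f, D f).
    by rewrite [LHS]surjective_pairing ga1 ga2 scaler0 addr0.
  move=> f g; have := congr1 (fun a : Dalg X K => a.2) (gaM (inF f) (inF g)).
  by rewrite inFM !gaF => e; rewrite [LHS]e addrC.
(* D f = f i - i f is undone by conjugation by the unit 1 - [0; i]. *)
have [i iP] := derX DL Dder.
pose J := 1 - inI i; pose J' := 1 + inI i.
have NN : inI i * inI i = 0 := inI_mul_inI i i.
have JV : J * J' = 1 by rewrite /J /J' mulrDr mulr1 mulrBl mul1r NN subr0 subrK.
have VJ : J' * J = 1 by rewrite /J /J' mulrBr mulr1 mulrDl mul1r NN addr0 addrK.
have gaE a : ga a = J * scale_tilde (c x0) a * J'.
  rewrite /J /J' mulrBl mul1r mulrDr mulr1 mulrBl inI_mul inI_mul_inI subr0 mul_inI.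
  rewrite [ga a]surjective_pairing ga1 ga2 -[D _]/(DL _) iP.
  apply: Dalg_ext => x y; first by rewrite -[RHS]/(a.1 x y - 0 + 0) subr0 addr0.
  rewrite -[LHS]/(lact a.1 i x y - ract i a.1 x y + c x0 * a.2 x y).
  rewrite -[RHS]/(c x0 * a.2 x y - ract i a.1 x y + lact a.1 i x y).
  by rewrite addrC addrCA addrC.
exists (c x0), (inF et * J), (J' * inF et'); split.
- exact: (mul_conj_inv HV JV).
- exact: (mul_conj_inv VJ VH).
have gaV a : be a = inF et * ga a * inF et'.
  by rewrite -[LHS]mul1r -[LHS]mulr1 -(mul_conj_cancel _ _ _ HV) !mul1r !mulr1.
by move=> a; rewrite gaV gaE !mulrA.
Qed.
End InnerScale.

(** * Centre and sign *)

Section Center.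
Context {d : Order.disp_t} {X : porderType d} {K : fieldType}.
Implicit Types (a b : Dalg X K) (x y z p q : X) (S : set X).

(** The central element [0; delta], of square 0. *)
Definition nu : Dalg X K := inI (delta X K).

Lemma nuC a : nu * a = a * nu.
Proof.
by rewrite inI_mul mul_inI /= /ract /lact delta_conv conv_delta.
Qed.

Lemma nu2 : nu * nu = 0. Proof. exact: inI_mul_inI. Qed.

(** The element [r delta; s delta]; the centre of D consists of these. *)
Definition central (r s : K) : Dalg X K :=
  (r *: delta X K, s *: (delta X K : incidence X K)).

Lemma centralE r s : central r s = r *: (1 : Dalg X K) + s *: (nu : Dalg X K).
Proof.
apply: Dalg_ext => x y.
  by rewrite -[RHS]/(r * delta X K x y + s * 0) mulr0 addr0.
by rewrite -[RHS]/(r * 0 + s * delta X K x y) mulr0 add0r.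
Qed.

Lemma centralM r s r' s' :
  central r s * central r' s' = central (r * r') (r * s' + s * r').
Proof.
rewrite !centralE mulrDl !mulrDr -!Dalg_scaleAl -!Dalg_scaleAr !mul1r mulr1 nu2.
by rewrite !scaler0 addr0 !scalerA scalerDl addrA.
Qed.

Lemma centralZ c r s : c *: central r s = central (c * r) (c * s).
Proof. by apply: Dalg_ext => x y; exact: mulrA. Qed.

Lemma central10 : central 1 0 = 1.
Proof. by rewrite centralE scale0r addr0 scale1r. Qed.

Lemma centralC r s a : central r s * a = a * central r s.
Proof.
by rewrite centralE mulrDl mulrDr -!Dalg_scaleAl -!Dalg_scaleAr nuC mul1r mulr1.
Qed.

Lemma central_inj (x0 : X) r s r' s' :
  central r s = central r' s' -> r = r' /\ s = s'.
Proof.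
move=> e; split.
  have := congr1 (fun a : Dalg X K => a.1 x0 x0) e.
  rewrite -[(central r s).1 x0 x0]/(r * diag_fun (fun=> 1) x0 x0).
  rewrite -[(central r' s').1 x0 x0]/(r' * diag_fun (fun=> 1) x0 x0).
  by rewrite /diag_fun eqxx !mulr1.
have := congr1 (fun a : Dalg X K => a.2 x0 x0) e.
rewrite -[(central r s).2 x0 x0]/(s * diag_fun (fun=> 1) x0 x0).
rewrite -[(central r' s').2 x0 x0]/(s' * diag_fun (fun=> 1) x0 x0).
by rewrite /diag_fun eqxx !mulr1.
Qed.

Lemma center_Dalg (x0 : X) (connX : connected_poset X) (z : Dalg X K) :
  (forall b, z * b = b * z) -> exists r s : K, z = central r s.
Proof.
move=> zC; exists (z.1 x0 x0), (z.2 x0 x0).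
have off := centralizer_eD (fun x => zC (eD x)).
have c1 x y : (x <= y)%O -> z.1 x x = z.1 y y.
  move=> xy; have := congr1 (fun a : Dalg X K => a.1 x y) (zC (eF x y)).
  have [xD _ _ _ _] := matrix_units_mul (K := K) xy (lexx y).
  by rewrite -[in RHS]xD -[in LHS]eD_mul_eF mulrA !mul_eD_mul1 !eF1 xy !eqxx mulr1 mul1r.
have c2 x y : (x <= y)%O -> z.2 x x = z.2 y y.
  move=> xy; have := congr1 (fun a : Dalg X K => a.2 x y) (zC (eF x y)).
  have [xD _ _ _ _] := matrix_units_mul (K := K) xy (lexx y).
  rewrite -[in RHS]xD -[in LHS]eD_mul_eF mulrA !mul_eD_mul2 !eF2 !eF1 xy !eqxx.
  by rewrite mulr1 mul1r mulr0 mul0r add0r addr0.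
have k1 x : z.1 x x = z.1 x0 x0 := connected_constant connX c1 x x0.
have k2 x : z.2 x x = z.2 x0 x0 := connected_constant connX c2 x x0.
apply: Dalg_ext => x y.
  rewrite -[RHS]/(z.1 x0 x0 * diag_fun (fun=> 1) x y) /diag_fun.
  case: eqVneq => [<-|xy]; first by rewrite mulr1.
  by rewrite mulr0; exact: (off x y xy).1.
rewrite -[RHS]/(z.2 x0 x0 * diag_fun (fun=> 1) x y) /diag_fun.
case: eqVneq => [<-|xy]; first by rewrite mulr1.
by rewrite mulr0; exact: (off x y xy).2.
Qed.

Lemma scale_tildeM k a b :
  scale_tilde k (a * b) = scale_tilde k a * scale_tilde k b.
Proof.
apply: Dalg_ext => x y //.
rewrite -[LHS]/(k * (conv a.1 b.2 x y + conv a.2 b.1 x y)) mulrDr; congr (_ + _).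
  exact (congr1 (fun i : incidence X K => i x y) (conv_scaleAr k a.1 b.2)).
exact (congr1 (fun i : incidence X K => i x y) (conv_scaleAl k a.2 b.1)).
Qed.

Lemma rho_scale_tilde (lam : poset_involution X) k a :
  rho_tilde lam (scale_tilde k a) = scale_tilde k (rho_tilde lam a).
Proof. by apply: Dalg_ext. Qed.

Lemma rho_tilde_nu (lam : poset_involution X) : rho_tilde lam nu = nu.
Proof.
apply: Dalg_ext => // x y.
by have := congr1 (fun a : Dalg X K => a.1 x y) (rho_tilde1 lam).
Qed.

Lemma involution_has_sign (x0 : X) (connX : connected_poset X)
  (multX : forall sigma : incidence X K,
     multiplicative_function sigma -> inner_automorphism (mult_map sigma))
  (derX : forall D : {linear FI X K -> incidence X K},
     derivation D -> inner_derivation D)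
  (lambda : poset_involution X) (Phi : {linear Dalg X K -> Dalg X K}) :
  is_involution Phi -> induces Phi lambda -> exists k, is_sign Phi k.
Proof.
move=> [PhiM PhiK] Phi_lam.
pose al : {linear Dalg X K -> Dalg X K} := Phi \o rho_tilde lambda.
have alM a b : al (a * b) = al a * al b by rewrite /al /= rho_tildeM PhiM.
have alK : cancel al (rho_tilde lambda \o Phi).
  by move=> a; rewrite /al /= PhiK rho_tildeK.
have alVK : cancel (rho_tilde lambda \o Phi) al.
  by move=> a; rewrite /al /= rho_tildeK PhiK.
have alC x : conjugate (al (eD x)) (eD x).
  rewrite /al /= rho_tilde_eD -{2}(poset_involutionK lambda x).
  exact: Phi_lam.
have [u [v [uv vu alu]]] := eD_simultaneously_conjugate lambda alM alK alVK alC.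
pose be a := v * al a * u.
have be_lin : linear be.
  move=> c a b; rewrite /be linearP mulrDr mulrDl.
  by rewrite -Dalg_scaleAr -Dalg_scaleAl.
pose beL : {linear Dalg X K -> Dalg X K} :=
  HB.pack be (GRing.isLinear.Build K (Dalg X K) (Dalg X K) *:%R be be_lin).
have al_be a : al a = u * be a * v.
  by rewrite /be !mulrA uv mul1r -mulrA uv mulr1.
have beM a b : be (a * b) = be a * be b.
  by rewrite /be alM !mulrA -(mulrA _ u v) uv mulr1.
have be_inj : injective be.
  by move=> a b ab; apply: (can_inj alK); rewrite !al_be ab.
have be_eD x : be (eD x) = eD x by rewrite /be -mulrA alu mulrA vu mul1r.
have [k [U [V [UV VU beE]]]] :=
  @automorphism_fixing_eD _ _ _ x0 connX multX derX beL beM be_inj be_eD.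
exists k.
pose P := u * U; pose Q := V * v.
have PQ : P * Q = 1 by exact: mul_conj_inv.
have QP : Q * P = 1 by exact: mul_conj_inv.
have PhiE a : Phi a = P * scale_tilde k (rho_tilde lambda a) * Q.
  have -> : Phi a = al (rho_tilde lambda a) by rewrite /al /= rho_tildeK.
  by rewrite al_be [be _]beE /P /Q !mulrA.
have Phi_nu : Phi nu = k *: nu.
  rewrite PhiE rho_tilde_nu.
  have -> : scale_tilde k nu = k *: nu.
    by apply: Dalg_ext => x y //; rewrite -[RHS]/(k * 0) mulr0.
  by rewrite -Dalg_scaleAr -Dalg_scaleAl -nuC -mulrA PQ mulr1.
have kk : k ^+ 2 = 1.
  have e : Phi (k *: nu) = k *: (k *: nu) by rewrite -[in RHS]Phi_nu; exact: linearZ.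
  have := congr1 (fun a : Dalg X K => a.2 x0 x0) (PhiK nu).
  by rewrite Phi_nu e !Dalg_scale2 /= /diag_fun eqxx mulr1.
split; first by move/eqP: kk; rewrite sqrf_eq1 => /orP[] /eqP; [right|left].
exists lambda, (fun a => P * a * Q); split=> //; first by exists P, Q.
by move=> a; rewrite PhiE /= rho_scale_tilde.
Qed.

Lemma induced_involution_unique (Phi : Dalg X K -> Dalg X K)
    (lam lam' : poset_involution X) :
  induces Phi lam -> induces Phi lam' -> lam =1 lam'.
Proof.
move=> h h' x; have := conjugate_diag1 (lam x) (h x).
rewrite -(conjugate_diag1 (lam x) (h' x)) /= /diag_fun !eqxx => /eqP.
by case: (lam x =P lam' x) => // _; rewrite oner_eq0.
Qed.
End Center.

(** * Normalising the conjugating unit *)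

Section Normalization.
Context {d : Order.disp_t} {X : porderType d} {K : fieldType}.
Implicit Types (a b : Dalg X K) (x y z p q : X) (S : set X).

Lemma scale_tilde_linear k : linear (scale_tilde k : Dalg X K -> Dalg X K).
Proof.
move=> c a b; apply: Dalg_ext => x y //.
rewrite -[LHS]/(k * (c * a.2 x y + b.2 x y)) mulrDr mulrCA //.
Qed.

HB.instance Definition _ k :=
  GRing.isLinear.Build K (Dalg X K) (Dalg X K) *:%R (scale_tilde k)
    (scale_tilde_linear k).

Section Normalize.
Variables (lam : poset_involution X) (k : K).
Hypothesis kk : k * k = 1.

(** The anti-automorphism to which every involution of sign k inducing lam is
    equal up to an inner automorphism. *)
Definition rho_scale : Dalg X K -> Dalg X K := rho_tilde lam \o scale_tilde k.
HB.instance Definition _ := GRing.Linear.copy rho_scale (rho_tilde lam \o scale_tilde k).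

Lemma rho_scaleM a b : rho_scale (a * b) = rho_scale b * rho_scale a.
Proof. by rewrite /rho_scale /= scale_tildeM rho_tildeM. Qed.

Lemma rho_scaleK : involutive rho_scale.
Proof.
move=> a; rewrite /rho_scale /= -rho_scale_tilde rho_tildeK.
by apply: Dalg_ext => x y //; rewrite -[LHS]/(k * (k * a.2 x y)) mulrA kk mul1r.
Qed.

Lemma rho_scale_diagD c : rho_scale (diagD c) = diagD (c \o lam).
Proof.
rewrite -rho_tilde_diagD /rho_scale /=; congr rho_tilde.
by apply: Dalg_ext => x y //; exact: mulr0.
Qed.

Lemma rho_scale1 : rho_scale 1 = 1.
Proof. exact: (rho_scale_diagD (fun=> 1)). Qed.

Lemma rho_scale_central r s :
  rho_scale (central r s) = central r (k * s).
Proof.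
have e x y : delta X K (lam y) (lam x) = delta X K x y.
  exact (congr1 (fun a : Dalg X K => a.1 x y) (rho_tilde1 lam)).
apply: Dalg_ext => x y.
  rewrite -[LHS]/(r * delta X K (lam y) (lam x)) e //.
by rewrite -[LHS]/(k * (s * delta X K (lam y) (lam x))) e mulrA.
Qed.

Local Notation th := rho_scale.

(** With z = th(a) a^-1 = [r delta; s delta], involutivity gives z th(z) = 1,
    that is r ^ 2 = 1 and k s = - s. Multiplying a by [delta; t delta] with
    t = r s / 2 makes the second component of z vanish. *)
Lemma normalize_unit (x0 : X) (connX : connected_poset X)
    (charK : 2%:R != 0 :> K) (a a' : Dalg X K) :
  a * a' = 1 -> a' * a = 1 ->
  involutive (fun b => a * rho_scale b * a') ->
  exists b b' r, [/\ b * b' = 1, b' * b = 1, r = 1 \/ r = -1,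
    rho_scale b = r *: b &
    forall c, a * rho_scale c * a' = b * rho_scale c * b'].
Proof.
move=> aa' a'a inv.
pose z := th a * a'.
have Vz : z * (a * th a') = 1.
  by rewrite /z mulrA -(mulrA _ a') a'a mulr1 -rho_scaleM a'a rho_scale1.
have zC b : z * b = b * z.
  rewrite -[in LHS](inv b) /= !rho_scaleM rho_scaleK.
  have -> : a * (th a' * (b * th a)) * a' = a * th a' * b * z.
    by rewrite /z !mulrA.
  by rewrite !mulrA -(mulrA z) Vz mul1r.
have [r [s zE]] := center_Dalg x0 connX zC.
have tha : th a = z * a by rewrite /z -mulrA a'a mulr1.
have thz : z * th z = 1.
  have : th (th a) = a by exact: rho_scaleK.
  rewrite {1}tha rho_scaleM tha => e.
  by rewrite -[LHS]mul1r -a'a -mulrA (mulrA a) -zC e.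
have /(central_inj x0)[rr] : central (r * r) (r * (k * s) + s * r) =
    central 1 0 :> Dalg X K.
  by rewrite central10 -centralM -rho_scale_central -zE.
rewrite (mulrC s) -mulrDr => /eqP; rewrite mulf_eq0.
have /negPf -> /= : r != 0.
  by apply/eqP => r0; move/eqP: rr; rewrite r0 mul0r eq_sym oner_eq0.
rewrite addr_eq0 => /eqP ks.
pose t := r * s / 2%:R.
have CC' : central 1 t * central 1 (- t) = 1 :> Dalg X K.
  by rewrite centralM !mul1r mulr1 addNr central10.
have C'C : central 1 (- t) * central 1 t = 1 :> Dalg X K.
  by rewrite centralM !mul1r mulr1 subrr central10.
exists (central 1 t * a), (a' * central 1 (- t)), r; split.
- exact: (mul_conj_inv CC' aa').
- exact: (mul_conj_inv a'a C'C).
- by move/eqP: rr; rewrite -expr2 sqrf_eq1 => /orP[] /eqP; [left|right].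
- have e : central r (k * t * r + s) = r *: central 1 t :> Dalg X K.
    have kt : k * t = - t by rewrite /t mulrA mulrCA ks mulrN mulNr.
    have t2 : t + t = r * s by rewrite /t; field.
    have sE : s = r * (t + t) by rewrite t2 mulrA rr mul1r.
    by rewrite centralZ mulr1 kt {1}sE; congr central; ring.
  have -> : th (central 1 t * a) = central r (k * t * r + s) * a.
    rewrite rho_scaleM rho_scale_central -centralC tha mulrA zE centralM.
    by rewrite !mul1r [s + _]addrC.
  by rewrite e Dalg_scaleAl.
by move=> c; rewrite -[LHS]mulr1 -C'C mulrA -centralC !mulrA.
Qed.

End Normalize.

Lemma rho_scaleD (lam : poset_involution X) k a b :
  rho_scale lam k (a + b) = rho_scale lam k a + rho_scale lam k b.
Proof. exact: linearD. Qed.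

(** For a lower set S the elements of D are block triangular. *)
Lemma indD_compl_corner S (down : forall x y, S y -> (x <= y)%O -> S x) a :
  (1 - indD S) * a * indD S = 0.
Proof.
have -> : 1 - indD S = diagD (fun x => 1 - `[< S x >]%:R) :> Dalg X K.
  apply: Dalg_ext => x y; last by rewrite -[LHS]/(0 - 0) subrr.
  rewrite -[LHS]/(diag_fun (fun=> 1) x y -
    diag_fun (fun x => `[< S x >]%:R) x y) /= /diag_fun.
  by case: eqP; rewrite ?subrr.
have Z (f : incidence X K) x y :
    (1 - `[< S x >]%:R) * f x y * `[< S y >]%:R = 0.
  have [Sy|nSy] := asboolP (S y); last by rewrite mulr0.
  have [xy|/incidenceP ->] := boolP (x <= y)%O; last by rewrite mulr0 mul0r.
  by rewrite asboolT ?subrr ?mul0r //; exact: down xy.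
apply: Dalg_ext => x y.
  by rewrite [LHS]mul_diagD1 diagD_mul1; exact: (Z a.1 x y).
by rewrite [LHS]mul_diagD2 diagD_mul2; exact: (Z a.2 x y).
Qed.
End Normalization.

Unset Implicit Arguments.

Theorem theorem6p13 (K : fieldType) (d : Order.disp_t) (X : porderType d)
  (charK : 2%N \notin [pchar K])
  (connX : connected_poset X)
  (multX : forall sigma : incidence X K,
     multiplicative_function sigma -> inner_automorphism (mult_map sigma))
  (derX : forall D : {linear FI X K -> incidence X K},
     derivation D -> inner_derivation D)
  (lambda : poset_involution X)
  (lambda_nofix : forall x : X, lambda x <> x)
  (X1 X2 : set X) (partX : is_partition lambda X1 X2)
  (Phi : {linear Dalg X K -> Dalg X K})
  (Phi_inv : is_involution Phi)
  (Phi_lambda : induces Phi lambda) :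
  exists Psi : Dalg X K -> Dalg X K, inner_automorphism Psi /\
    (Phi \o Psi =1 Psi \o rho_tilde lambda \o scale_tilde (involution_sign Phi) \/
     Phi \o Psi =1 Psi \o sigma_tilde lambda X1 \o scale_tilde (involution_sign Phi)).
Proof.
have [[x0 _]|noX] := pselect (exists x : X, True); last first.
  exists id; split.
    by exists 1, 1; rewrite mulr1; split=> // a; rewrite mul1r mulr1.
  by left=> a; apply: Dalg_ext => x; case: noX; exists x.
(* From now on X is nonempty, with x0 in X; for empty X the algebra is trivial. *)
have two0 : 2%:R != 0 :> K by move: charK; rewrite inE /=.
have [kpm [lam' [Psi0 [ind' [a [a' [aa' a'a Psi0E]]] PhiE0]]]] :
    is_sign Phi (involution_sign Phi).
  apply: (xgetPex 0).
  exact: involution_has_sign x0 connX multX derX _ _ Phi_inv Phi_lambda.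
set k := involution_sign Phi in kpm PhiE0 *.
have kk : k * k = 1 by case: kpm => ->; rewrite ?mulrNN mulr1.
(* The sign comes with an involution lam' of its own, which has to be lambda. *)
have ll : lambda =1 lam' := induced_involution_unique Phi_lambda ind'.
pose th : Dalg X K -> Dalg X K := rho_scale lambda k.
have PhiE b : Phi b = a * th b * a'.
  have -> : th b = rho_tilde lam' (scale_tilde k b).
    by apply: Dalg_ext => x y; rewrite /= /rho_fun /= !ll.
  by rewrite PhiE0 [LHS]Psi0E.
have inv : involutive (fun b => a * th b * a').
  by move=> b; rewrite -!PhiE; exact: Phi_inv.2.
have [b [b' [r [bb' b'b rpm thb PhiE']]]] := normalize_unit kk x0 connX two0 aa' a'a inv.
pose E : Dalg X K := indD X1.
pose h : Dalg X K := central (2%:R^-1) 0.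
have X1lam x : X1 (lambda x) <-> ~ X1 x.
  have [cover disj [im1 im2] _ _] := partX; split.
    move=> Xl Xx; have : (X1 `&` X2) (lambda x) by split=> //; rewrite -im1; exists x.
    by rewrite disj.
  move=> nX; have : (X1 `|` X2) x by rewrite cover.
  by case=> // X2x; rewrite -im2; exists x.
have thD x y : th (x + y) = th x + th y := rho_scaleD lambda k x y.
have thM x y : th (x * y) = th y * th x := rho_scaleM lambda k x y.
have thK : involutive th := rho_scaleK lambda kk.
have EE : E * E = E.
  rewrite diagDM; apply: diagD_eq => x.
  by case: asboolP; rewrite ?mulr1 ?mulr0.
have thE : th E = 1 - E.
  rewrite /th rho_scale_diagD.
  apply: Dalg_ext => x y; last by rewrite -[RHS]/(0 - 0) subrr.
  rewrite -[RHS]/(diag_fun (fun=> 1) x y -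
    diag_fun (fun x => `[< X1 x >]%:R) x y) /= /diag_fun.
  case: eqP => _; rewrite ?subrr //=.
  case: (asboolP (X1 x)) => Xx; first by rewrite asboolF ?subrr // => /X1lam.
  by rewrite asboolT ?subr0 //; exact/X1lam.
have corner c : (1 - E) * c * E = 0.
  by apply: indD_compl_corner => x y Xy xy; case: partX => _ _ _ down _; exact: down xy.
have hC c : h * c = c * h := centralC _ _ c.
have hh : h + h = 1.
  rewrite /h -central10 !centralE !scale0r !addr0 -scalerDl; congr (_ *: _); field.
  exact: two0.
have thh : th h = h by rewrite /th rho_scale_central mulr0.
have PhiB c : Phi c = b * th c * b' by rewrite PhiE PhiE'.
case: rpm => rE; rewrite rE in thb.
  rewrite scale1r in thb.
  have [g [g' [gg' g'g gE]]] := antiinvolution_conjugation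
    thD thM thK EE thE corner hC hh thh bb' b'b thb.
  exists (fun c => g * c * g'); split; first by exists g, g'.
  by left=> c; rewrite /= PhiB gE.
rewrite scaleN1r in thb.
have {}thb : th b = - b := thb.
(* In the skew case th(b) = - b, also th(w) = - w; hence b w^-1 is symmetric for
   the involution th2 obtained from th by conjugation with w. *)
pose W : Dalg X K := (w K X1, 0); pose W' : Dalg X K := (w_inv K X1, 0).
have WW' : W * W' = 1 by rewrite [LHS]inFM w_mulV.
have W'W : W' * W = 1 by rewrite [LHS]inFM w_Vmul.
have wlam x : w_coef K X1 (lambda x) = - w_coef K X1 x.
  rewrite /w_coef; have [Xx|nXx] := pselect (X1 x).
    by rewrite (mem_set Xx) memNset // => /X1lam.
  by rewrite (memNset nXx) mem_set ?opprK //; exact/X1lam.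
have thW : th W = - W.
  rewrite [LHS]rho_scale_diagD; apply: Dalg_ext => x y.
    rewrite -[RHS]/(- diag_fun (w_coef K X1) x y) /= /diag_fun /=.
    by case: eqP => _; rewrite ?wlam ?oppr0.
  by rewrite -[RHS]/(- 0) oppr0.
have thW' : th W' = - W'.
  have e : th W' * th W = 1 by rewrite -thM WW' [LHS]rho_scale1.
  by rewrite -[LHS]mulr1 -WW' mulrA -[W in LHS]opprK -thW mulrN e mulN1r.
have WE : W * E = E * W.
  by rewrite [LHS]diagDM [RHS]diagDM; apply: diagD_eq => x; rewrite mulrC.
pose th2 c := W * th c * W'.
have th2_sigma c : sigma_tilde lambda X1 (scale_tilde k c) = th2 c.
  apply: Dalg_ext => x y //.
  transitivity (w_coef K X1 x * (th c).2 x y * (w_coef K X1 y)^-1).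
    by rewrite [LHS]conv_diagr [X in X * _]conv_diagl.
  by rewrite [RHS]mul_diagD2 [X in _ = X * _]diagD_mul2.
have th2D x y : th2 (x + y) = th2 x + th2 y by rewrite /th2 thD mulrDr mulrDl.
have th2M x y : th2 (x * y) = th2 y * th2 x.
  by rewrite /th2 thM !mulrA -[in RHS](mulrA _ W' W) W'W mulr1.
have th2K : involutive th2.
  move=> c; rewrite /th2 !thM thK thW thW' mulNr !mulrN opprK !mulrA WW' mul1r.
  by rewrite -mulrA WW' mulr1.
have th2E : th2 E = 1 - E.
  by rewrite /th2 thE mulrBr mulr1 mulrBl WW' WE -mulrA WW' mulr1.
have th2h : th2 h = h by rewrite /th2 thh -hC -mulrA WW' mulr1.
have th2a : th2 (b * W') = b * W'.
  by rewrite /th2 thM thW' thb mulrNN !mulrA WW' mul1r.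
have [g [g' [gg' g'g gE]]] := antiinvolution_conjugation th2D th2M th2K EE th2E
  corner hC hh th2h (mul_conj_inv bb' W'W) (mul_conj_inv WW' b'b) th2a.
exists (fun c => g * c * g'); split; first by exists g, g'.
right=> c; rewrite /= th2_sigma -gE PhiB.
exact: esym (mul_conj_cancel _ _ _ W'W).
Qed.
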